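(* Let $\phi$ be a linear formula on a finite set of variables $\mathcal{V}_1$ and $\psi$ a linear formula on a finite set of variables $\mathcal{V}_2$, and suppose $\phi \to \psi$ is a linear inference. If $|\mathcal{V}_1 \cap \mathcal{V}_2| \leq 7$, then $\phi$ is $\{\mathsf{s},\mathsf{m}\}$-derivable with units to $\psi$. Furthermore, there exists a linear inference $\phi \to \psi$ on $8$ variables such that $\psi$ is not $\{\mathsf{s},\mathsf{m}\}$-derivable with units from $\phi$; hence $7$ is the largest number with the property above.
   Context: Fix a countably infinite set of variables. Linear formulae on a finite set $\mathcal{V}$ of variables are defined inductively: - $\top$ and $\bot$ are linear formulae on $\emptyset$. - For a variable $x$, both $x$ and $\neg x$ are linear formulae on $\{x\}$. - If $\phi$ is on $\mathcal{V}_1$, $\psi$ is on $\mathcal{V}_2$ and $\mathcal{V}_1 \cap \mathcal{V}_2 = \emptyset$, then $\phi \lor \psi$ and $\phi \land \psi$ are linear formulae on $\mathcal{V}_1 \cup \mathcal{V}_2$. Formulae are evaluated under assignments $\alpha$ from variables to $\{0,1\}$ in the usual Boolean way. A linear inference is a pair $\phi \to \psi$ of linear formulae, possibly on different variable sets, such that every assignment satisfying $\phi$ also satisfies $\psi$. An inference is on $n$ variables if both sides are linear formulae on a common set $\mathcal{V}$ with $|\mathcal{V}| = n$. A congruence is an equivalence relation on linear formulae closed under contexts: $\phi \sim \psi$ implies $\phi \land \chi \sim \psi\land\chi$, $\chi\land\phi\sim\chi\land\psi$, and the same for $\lor$. - $\sim_{\mathsf{ac}}$ is the smallest congruence containing commutativity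 and associativity of $\land$ and of $\lor$. - $\sim_{\mathsf{u}}$ is the smallest congruence containing $\phi\land\top\sim\phi$, $\top\land\phi\sim\phi$, $\phi\lor\bot\sim\phi$, $\bot\lor\phi\sim\phi$, $\phi\land\bot\sim\bot$, $\bot\land\phi\sim\bot$, $\phi\lor\top\sim\top$ and $\top\lor\phi\sim\top$. - $\sim_{\mathsf{acu}}$ is the smallest congruence containing both $\sim_{\mathsf{ac}}$ and $\sim_{\mathsf{u}}$. For a set $S$ of linear inferences, $\to_S$ is the smallest relation containing each inference of $S$ and closed under substitution of linear formulae for variables (keeping linearity) and under contexts. Write $\phi \rightsquigarrow_{S\mathsf{u}} \psi$ if there are $\phi',\psi'$ with $\phi \sim_{\mathsf{acu}} \phi' \to_S \psi' \sim_{\mathsf{acu}} \psi$. The inference $\phi\to\psi$ is $S$-derivable with units if $\phi$ and $\psi$ are related by the reflexive-transitive closure of $\rightsquigarrow_{S\mathsf{u}} \cup \sim_{\mathsf{acu}}$. Switch $\mathsf{s}$ is the inference $x \land (y \lor z) \to (x\land y)\lor z$, and medial $\mathsf{m}$ is the inference $(w\land x)\lor(y\land z) \to (w\lor y)\land(x\lor z)$. *)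

(* Defs.v *)
From mathcomp Require Import all_boot.
Set Implicit Arguments. Unset Strict Implicit. Unset Printing Implicit Defensive.

Inductive form : Type :=
| Top | Bot
| Var of nat
| NVar of nat
| And of form & form
| Or of form & form.

Fixpoint vars (f : form) : seq nat :=
  match f with
  | Top | Bot => [::]
  | Var x | NVar x => [:: x]
  | And a b | Or a b => vars a ++ vars b
  end.

Definition linear (f : form) : bool := uniq (vars f).

(* f is a linear formula on the finite set V (given as a duplicate-free list) *)
Definition linear_on (f : form) (V : seq nat) : Prop :=
  linear f /\ vars f =i V.

Fixpoint eval (a : nat -> bool) (f : form) : bool :=
  match f with
  | Top => true
  | Bot => false
  | Var x => a x
  | NVar x => ~~ a x
  | And f g => eval a f && eval a g
  | Or f g => eval a f || eval a g
  end.

Definition inference (phi psi : form) : Prop :=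
  linear phi /\ linear psi /\ forall a, eval a phi -> eval a psi.

Fixpoint neg (f : form) : form :=
  match f with
  | Top => Bot
  | Bot => Top
  | Var x => NVar x
  | NVar x => Var x
  | And a b => Or (neg a) (neg b)
  | Or a b => And (neg a) (neg b)
  end.

Fixpoint subst (s : nat -> form) (f : form) : form :=
  match f with
  | Top => Top
  | Bot => Bot
  | Var x => s x
  | NVar x => neg (s x)
  | And a b => And (subst s a) (subst s b)
  | Or a b => Or (subst s a) (subst s b)
  end.

Inductive acu : form -> form -> Prop :=
| acu_refl a : linear a -> acu a a
| acu_sym a b : acu a b -> acu b a
| acu_trans a b c : acu a b -> acu b c -> acu a c
| acu_andC a b : linear (And a b) -> acu (And a b) (And b a)
| acu_orC a b : linear (Or a b) -> acu (Or a b) (Or b a)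
| acu_andA a b c : linear (And a (And b c)) ->
    acu (And a (And b c)) (And (And a b) c)
| acu_orA a b c : linear (Or a (Or b c)) ->
    acu (Or a (Or b c)) (Or (Or a b) c)
| acu_andT a : linear a -> acu (And a Top) a
| acu_Tand a : linear a -> acu (And Top a) a
| acu_orB a : linear a -> acu (Or a Bot) a
| acu_Bor a : linear a -> acu (Or Bot a) a
| acu_andB a : linear a -> acu (And a Bot) Bot
| acu_Band a : linear a -> acu (And Bot a) Bot
| acu_orT a : linear a -> acu (Or a Top) Top
| acu_Tor a : linear a -> acu (Or Top a) Top
| acu_ctx_andl a b c : acu a b -> linear (And a c) -> linear (And b c) ->
    acu (And a c) (And b c)
| acu_ctx_andr a b c : acu a b -> linear (And c a) -> linear (And c b) ->
    acu (And c a) (And c b)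
| acu_ctx_orl a b c : acu a b -> linear (Or a c) -> linear (Or b c) ->
    acu (Or a c) (Or b c)
| acu_ctx_orr a b c : acu a b -> linear (Or c a) -> linear (Or c b) ->
    acu (Or c a) (Or c b).

Inductive step (S : form -> form -> Prop) : form -> form -> Prop :=
| step_inst l r (s : nat -> form) : S l r ->
    linear (subst s l) -> linear (subst s r) -> step S (subst s l) (subst s r)
| step_ctx_andl a b c : step S a b -> linear (And a c) -> linear (And b c) ->
    step S (And a c) (And b c)
| step_ctx_andr a b c : step S a b -> linear (And c a) -> linear (And c b) ->
    step S (And c a) (And c b)
| step_ctx_orl a b c : step S a b -> linear (Or a c) -> linear (Or b c) ->
    step S (Or a c) (Or b c)
| step_ctx_orr a b c : step S a b -> linear (Or c a) -> linear (Or c b) ->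
    step S (Or c a) (Or c b).

Definition rew_Su (S : form -> form -> Prop) (phi psi : form) : Prop :=
  exists phi' psi', acu phi phi' /\ step S phi' psi' /\ acu psi' psi.

Inductive rtc (R : form -> form -> Prop) : form -> form -> Prop :=
| rtc_refl a : rtc R a a
| rtc_step a b c : R a b -> rtc R b c -> rtc R a c.

Definition derivable_u (S : form -> form -> Prop) (phi psi : form) : Prop :=
  rtc (fun a b => rew_Su S a b \/ acu a b) phi psi.

Definition switch_l := And (Var 0) (Or (Var 1) (Var 2)).
Definition switch_r := Or (And (Var 0) (Var 1)) (Var 2).
Definition medial_l := Or (And (Var 0) (Var 1)) (And (Var 2) (Var 3)).
Definition medial_r := And (Or (Var 0) (Var 2)) (Or (Var 1) (Var 3)).

Definition SM (l r : form) : Prop :=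
  (l = switch_l /\ r = switch_r) \/ (l = medial_l /\ r = medial_r).

(* Main.v *)
(* Everything reduces to inferences [phi -> psi] with [phi] a conjunction, [psi] a disjunction, and the same
   variables with the same polarities on both sides: weakening [x -> T], [F -> x] is derivable from switch
   and units; if [psi = psi1 /\ psi2], medial and units derive
   [phi -> phi[T off psi1] /\ phi[T on psi1]], whose conjuncts imply [psi1] and [psi2]; dually if [phi] is a
   disjunction.  If [phi = x /\ phi'], then [phi' -> psi[x := T]] is smaller and switch pushes [x] back to its
   occurrence in [psi]; dually for [psi].  In the remaining case a computation over all pairs on at
   most 7 variables shows that a disjunct of a conjunct of [phi] implies [psi], or dually; one switch
   then makes [phi] a disjunction.
   For the counterexample on 8 variables, every formula [f] on a derivation satisfies
   [phi8 <= f <= psi8], which forces all 8 variables to occur essentially.  Hence units play no role, and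
   one checks that every switch or medial step out of [phi8] leads to a formula that does not imply [psi8]. *)
Require Import Defs.
From HB Require Import structures.
From mathcomp Require Import all_boot zify.

Set Implicit Arguments. Unset Strict Implicit. Unset Printing Implicit Defensive.
Set Bullet Behavior "Strict Subproofs".

(** The induction runs on the total [weight] of both sides, not on the number of variables. Units
    weigh less than literals, so erasing a literal or simplifying a unit lowers the weight, while
    switch preserves it; hence both disjuncts produced by the switch that the computation finds are
    still covered by the induction hypothesis. No reduction creates variables, so the bound 7 is
    inherited throughout. Switch and medial are self-dual up to commutativity, so each reduction is
    proved on one side only. The computation is finite and feasible because two sides with the same
    literals can be renamed to positive formulae, with variables numbered by their order in [phi].
    Such formulae are monotone, and implication is tested on minterms. In the lower bound a
    derivation may pass through units and through variables outside the eight. Stray variables are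
    replaced by [Bot] and units are simplified away. A step can degenerate to a weakening under
    simplification only by discarding a variable, which the essential occurrence of all eight
    forbids. *)

Lemma form_comparable : comparable form.
Proof. by move=> f g; rewrite /decidable; do !decide equality. Qed.

HB.instance Definition _ := hasDecEq.Build form (compareP form_comparable).

Definition op (b : bool) : form -> form -> form := if b then And else Or.

Definition le (f g : form) : Prop := forall s, eval s f -> eval s g.

(** * Linearity, evaluation and single steps *)

Lemma uniq_countP (s : seq nat) : reflect (forall x : nat, count_mem x s <= 1) (uniq s).
Proof.
apply: (iffP idP) => [/count_uniq_mem cE x|c1]; first by rewrite cE leq_b1.
by apply: count_mem_uniq => x; move: (c1 x); rewrite -has_pred1 has_count; case: count => [|[]].
Qed.

Lemma linearP f : reflect (forall x : nat, count_mem x (vars f) <= 1) (linear f).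
Proof. exact: uniq_countP. Qed.

(** Linearity is read as a bound of 1 on the multiplicity of each variable. Multiplicities add up
    along [vars], so goals about rearranged formulae become linear arithmetic. *)
Ltac cnt :=
  repeat match goal with
  | H : is_true (linear _) |- _ => move/linearP in H
  | H : is_true (perm_eq _ _) |- _ => move/permP in H
  end;
  match goal with
  | |- is_true (linear _) => apply/linearP
  | |- is_true (uniq _) => apply/uniq_countP
  | |- is_true (perm_eq _ _) => apply/permP
  | _ => idtac
  end;
  let p := fresh "p" in
  move=> p;
  repeat match goal with
  | H : forall x : nat, is_true (count_mem x _ <= 1) |- _ => move: (H p) => {H}
  | H : _ =1 _ |- _ => 
    (move: (H p) => {H}) || (move: (H (pred1 p)) => {H})
  end;
  rewrite /= ?count_cat /= ?count_cat /= ?count_cat /=; lia.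

Lemma linear_perm f g : perm_eq (vars f) (vars g) -> linear f = linear g.
Proof. exact: perm_uniq. Qed.

Lemma linear_and f g : linear (And f g) -> linear f /\ linear g.
Proof. by move=> l; split; cnt. Qed.

Lemma linear_op b f g : linear (op b f g) = linear (And f g).
Proof. by case: b. Qed.

Lemma acu_linear f g : acu f g -> linear f /\ linear g.
Proof.
elim=> //= {f g}.
1: by move=> f g _ [].
1: by move=> f g h _ [] ? _ _ [].
all: by move=> *; split=> //; cnt.
Qed.

Lemma acu_eval f g : acu f g -> forall s, eval s f = eval s g.
Proof.
elim=> {f g} //= [f g h _ IH1 _ IH2|f g _|f g _|f g h _|f g h _|f _|f _|f _|f _|f g h _ IH _ _|f g h _ IH _ _|f g h _ IH _ _|f g h _ IH _ _] s;
  rewrite ?IH1 ?IH2 ?IH ?andbT ?andbF ?orbT ?orbF ?andbA ?orbA //; first exact: andbC; exact: orbC.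
Qed.

Lemma eval_neg s f : eval s (neg f) = ~~ eval s f.
Proof. by elim: f => //= [x|f IHf g IHg|f IHf g IHg]; rewrite ?negbK // IHf IHg ?negb_and ?negb_or. Qed.

Lemma negK f : neg (neg f) = f.
Proof. by elim: f => //= f -> g ->. Qed.

Lemma vars_neg f : vars (neg f) = vars f.
Proof. by elim: f => //= f -> g ->. Qed.

Lemma linear_neg f : linear (neg f) = linear f.
Proof. by rewrite /linear vars_neg. Qed.

Lemma le_neg f g : le f g -> le (neg g) (neg f).
Proof. by move=> fg s; rewrite !eval_neg; apply: contra; apply: fg. Qed.

Lemma vars_subst t f : vars (subst t f) = flatten [seq vars (t x) | x <- vars f].
Proof. by elim: f => //= [x|x|f -> g ->|f -> g ->]; rewrite ?vars_neg ?cats0 // map_cat flatten_cat. Qed.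

Lemma subst_neg t f : subst t (neg f) = neg (subst t f).
Proof. by elim: f => //= [x|f -> g ->|f -> g ->] //; rewrite negK. Qed.

Lemma subst_comp t u f : subst u (subst t f) = subst (fun x => subst u (t x)) f.
Proof. by elim: f => //= [x|f -> g ->|f -> g ->] //; rewrite subst_neg. Qed.

Lemma eval_ext s t f : {in vars f, s =1 t} -> eval s f = eval t f.
Proof.
elim: f => //= [x|x|f IHf g IHg|f IHf g IHg] e; rewrite ?(e x) ?inE //;
  by rewrite IHf ?IHg // => x xf; apply: e; rewrite mem_cat xf ?orbT.
Qed.

Lemma step_vars f g : step SM f g -> perm_eq (vars f) (vars g).
Proof.
elim=> {f g} [l r t [[-> ->]|[-> ->]] _ _|f g h _ IH _ _|f g h _ IH _ _|f g h _ IH _ _|f g h _ IH _ _]; by cnt.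
Qed.

Lemma step_linear f g : step SM f g -> linear f /\ linear g.
Proof. by case. Qed.

Lemma step_sound f g : step SM f g -> le f g.
Proof.
elim=> {f g} [l r t lr _ _|f g h _ IH _ _|f g h _ IH _ _|f g h _ IH _ _|f g h _ IH _ _] s /=;
  last 4 first.
- by case/andP=> /IH-> ->.
- by case/andP=> -> /IH->.
- by case/orP=> [/IH->|->] //; rewrite orbT.
- by case/orP=> [->|/IH->] //; rewrite orbT.
- case: lr => [] [-> ->] /=; move: (t 0) (t 1) (t 2) (t 3) => a b c d;
  by case: (eval s a); case: (eval s b); case: (eval s c); case: (eval s d).
Qed.

Lemma step_switch f g h : linear (And f (Or g h)) -> step SM (And f (Or g h)) (Or (And f g) h).
Proof.
move=> l; apply: (@step_inst _ switch_l switch_r (nth Top [:: f; g; h])) => //; first by left.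
by rewrite /=; cnt.
Qed.

Lemma step_medial e f g h :
  linear (Or (And e f) (And g h)) -> step SM (Or (And e f) (And g h)) (And (Or e g) (Or f h)).
Proof.
move=> l; apply: (@step_inst _ medial_l medial_r (nth Top [:: e; f; g; h])) => //; first by right.
by rewrite /=; cnt.
Qed.

(** * Derivations on a fixed set of variables *)

(* Derivability through formulae on [V] only.  Tracking [V] is what makes the
   relation closed under contexts: [acu] may introduce arbitrary variables
   next to an absorbing unit, and these could clash with the context. *)
Inductive der (V : seq nat) : form -> form -> Prop :=
| der_acu f g : acu f g -> {subset vars f <= V} -> {subset vars g <= V} -> der V f g
| der_step f g : step SM f g -> {subset vars f <= V} -> der V f g
| der_trans f g h : der V f g -> der V g h -> der V f h.

Lemma der_linear V f g : der V f g -> linear f /\ linear g.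
Proof.
elim=> {f g} [f g /acu_linear|f g /step_linear|f g h _ [? _] _ []] //.
Qed.

Lemma der_vars V f g : der V f g -> {subset vars f <= V} /\ {subset vars g <= V}.
Proof.
elim=> {f g} [f g _|f g fg fV|f g h _ [? _] _ []] //.
by split=> // x; rewrite -(perm_mem (step_vars fg)); apply: fV.
Qed.

Lemma der_sound V f g : der V f g -> le f g.
Proof.
elim=> {f g} [f g /acu_eval e _ _ s|f g /step_sound //|f g h _ IH1 _ IH2 s /IH1/IH2 //].
by rewrite e.
Qed.

Lemma der_mono (V W : seq nat) f g : {subset V <= W} -> der V f g -> der W f g.
Proof.
move=> VW; elim=> {f g} [f g fg fV gV|f g fg fV|f g h _ fg _ gh].
- by apply: der_acu => // x => [/fV|/gV] /VW.
- by apply: der_step => // x /fV/VW.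
- exact: der_trans fg gh.
Qed.

Lemma der_refl V f : linear f -> {subset vars f <= V} -> der V f f.
Proof. by move=> lf fV; apply: der_acu => //; apply: acu_refl. Qed.

Lemma derivable_der V f g : der V f g -> derivable_u SM f g.
Proof.
have rtc1 R a b : R a b -> rtc R a b by move=> r; apply: rtc_step r _; apply: rtc_refl.
elim=> {f g} [f g fg _ _|f g fg _|f g h _ fg _ gh].
- by apply: rtc1; right.
- have [lf lg] := step_linear fg.
  by apply: rtc1; left; exists f, g; do !split => //; apply: acu_refl.
- elim: fg gh => // a b c ab _ IH /IH; exact: rtc_step.
Qed.

(** A derivation is finite, so the variables of all its formulae fit into one list. Linearity of [f]
    has to be assumed because an empty derivation does not supply it. *)
Lemma der_derivable f g : derivable_u SM f g -> linear f -> exists V, der V f g.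
Proof.
elim=> {f g} [f lf|f g h fg _ IH lf]; first by exists (vars f); apply: der_refl.
have [V [lg dV]] : exists V, linear g /\ der V f g.
  case: fg => [[f' [g' [ff' [fg' gg']]]]|fg].
    have [_ lg] := acu_linear gg'.
    exists (vars f ++ vars f' ++ vars g' ++ vars g); split=> //.
    apply: (der_trans (g := f')); first by apply: der_acu => // x xf; rewrite !mem_cat xf ?orbT.
    apply: (der_trans (g := g')); first by apply: der_step => // x xf; rewrite !mem_cat xf ?orbT.
    by apply: der_acu => // x xf; rewrite !mem_cat xf ?orbT.
  have [_ lg] := acu_linear fg.
  by exists (vars f ++ vars g); split=> //; apply: der_acu => // x xf; rewrite !mem_cat xf ?orbT.
have [W dW] := IH lg; exists (V ++ W).
by apply: (der_trans (g := g)); [move: dV|move: dW]; apply: der_mono => x; rewrite mem_cat => ->; rewrite ?orbT.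
Qed.

Lemma linear_disj b f g (V : seq nat) :
  linear f -> linear g -> {subset vars f <= V} -> {in vars g, forall x, x \notin V} -> linear (op b f g).
Proof.
move=> lf lg fV gV; rewrite linear_op /linear /= cat_uniq -!/(linear _) lf lg andbT /=.
by apply/hasPn => x /gV; apply: contra => /fV.
Qed.

Lemma acu_opC b f g : linear (op b f g) -> acu (op b f g) (op b g f).
Proof. by case: b => l; [apply: acu_andC|apply: acu_orC]. Qed.

Lemma acu_opA b f g h : linear (op b f (op b g h)) -> acu (op b f (op b g h)) (op b (op b f g) h).
Proof. by case: b => l; [apply: acu_andA|apply: acu_orA]. Qed.

Lemma acu_opl b f g h : acu f g -> linear (op b f h) -> linear (op b g h) -> acu (op b f h) (op b g h).
Proof. by case: b => ? ? ?; [apply: acu_ctx_andl|apply: acu_ctx_orl]. Qed.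

Lemma vars_op b f g : vars (op b f g) = vars f ++ vars g.
Proof. by case: b. Qed.

Lemma der_opl b (V W : seq nat) f g h : der V f g -> linear h -> {in vars h, forall x, x \notin V} ->
  {subset V <= W} -> {subset vars h <= W} -> der W (op b f h) (op b g h).
Proof.
move=> fg lh hV VW hW; elim: fg => {f g} [f g fg fV gV|f g fg fV|f g k _ fg _ gk].
- have [lf lg] := acu_linear fg.
  apply: der_acu; first by apply: acu_opl => //; apply: linear_disj hV.
  all: by move=> x; rewrite vars_op mem_cat => /orP[]; auto.
- have [lf lg] := step_linear fg.
  have gV : {subset vars g <= V} by move=> x; rewrite -(perm_mem (step_vars fg)); apply: fV.
  apply: der_step; last by move=> x; rewrite vars_op mem_cat => /orP[]; auto.
  have := linear_disj b lf lh fV hV; have := linear_disj b lg lh gV hV.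
  by case: b => ? ?; [apply: step_ctx_andl|apply: step_ctx_orl].
- exact: der_trans fg gk.
Qed.

Lemma der_opC b V f g : linear (op b f g) -> {subset vars (op b f g) <= V} -> der V (op b f g) (op b g f).
Proof.
move=> l s; apply: der_acu => //; first exact: acu_opC.
by move=> x xgf; apply: s; move: xgf; rewrite !vars_op !mem_cat orbC.
Qed.

Lemma der_op b (V W X : seq nat) f f' g g' : der V f f' -> der W g g' -> {in W, forall x, x \notin V} ->
  {subset V <= X} -> {subset W <= X} -> der X (op b f g) (op b f' g').
Proof.
move=> ff gg WV VX WX.
have [[lf lf'] [lg lg']] := (der_linear ff, der_linear gg).
have [[fV fV'] [gW gW']] := (der_vars ff, der_vars gg).
have gV : {in vars g, forall x, x \notin V} by move=> x /gW/WV.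
have gV' : {in vars g', forall x, x \notin V} by move=> x /gW'/WV.
have fW' : {in vars f', forall x, x \notin W} by move=> x /fV'; apply: contraL => /WV.
have sX h k : {subset vars h <= V} -> {subset vars k <= W} -> {subset vars (op b h k) <= X} /\ {subset vars (op b k h) <= X}.
  by move=> hV kW; split=> x; rewrite vars_op mem_cat => /orP[]; auto.
(* Only left arguments can be rewritten by [der_opl], hence the swap in between. [g] avoids all of
   [V] and [f'] all of [W], so no intermediate formula clashes with its context. *)
apply: (der_trans (g := op b f' g)).
  by apply: der_opl ff _ _ _ _ => // x /gW/WX.
apply: (der_trans (g := op b g f')).
  by apply: der_opC; [apply: linear_disj gV|case: (sX f' g)].
apply: (der_trans (g := op b g' f')).
  by apply: der_opl gg _ _ _ _ => // x /fV'/VX.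
apply: der_opC; last by case: (sX f' g').
by rewrite linear_op; have := linear_disj true lf' lg' fV' gV'; rewrite !linear_op => ?; cnt.
Qed.

Lemma der_op_vars b f f' g g' :
  der (vars f) f f' -> der (vars g) g g' -> linear (op b f g) ->
  der (vars (op b f g)) (op b f g) (op b f' g').
Proof.
move=> ff gg; rewrite linear_op /linear /= cat_uniq => /and3P[_ /hasPn d _].
by apply: der_op ff gg _ _ _ => // x xf; rewrite vars_op mem_cat xf ?orbT.
Qed.

(** * Duality and substitution *)

Lemma acu_neg f g : acu f g -> acu (neg f) (neg g).
Proof.
elim=> {f g} /=.
1: by move=> f lf; apply: acu_refl; rewrite linear_neg.
1: by move=> *; apply: acu_sym.
1: by move=> f g h _ ? _ ?; apply: acu_trans; eassumption.
all: intros; first [apply: acu_orC | apply: acu_andC | apply: acu_orA | apply: acu_andA | apply: acu_orB | apply: acu_Bor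
  | apply: acu_andT | apply: acu_Tand | apply: acu_orT | apply: acu_Tor | apply: acu_andB | apply: acu_Band
  | apply: acu_ctx_orl | apply: acu_ctx_orr | apply: acu_ctx_andl | apply: acu_ctx_andr];
  by rewrite // /linear /= ?vars_neg.
Qed.

Lemma subset_cat (s t u : seq nat) : {subset s <= u} -> {subset t <= u} -> {subset s ++ t <= u}.
Proof. by move=> su tu x; rewrite mem_cat => /orP[/su|/tu]. Qed.

Lemma subsetl (s t : seq nat) : {subset s <= s ++ t}.
Proof. by move=> x; rewrite mem_cat => ->. Qed.

Lemma subsetr (s t : seq nat) : {subset t <= s ++ t}.
Proof. by move=> x; rewrite mem_cat orbC => ->. Qed.

Lemma linear_op_disj b f g : linear (op b f g) -> {in vars g, forall x, x \notin vars f}.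
Proof. by rewrite linear_op /linear /= cat_uniq => /and3P[_ /hasPn]. Qed.

Lemma linear_opI b f g : linear (op b f g) -> linear f /\ linear g.
Proof. by rewrite linear_op => /linear_and. Qed.

Lemma neg_op b f g : neg (op b f g) = op (~~ b) (neg f) (neg g).
Proof. by case: b. Qed.

(** Switch is self-dual: negated and read backwards it is the switch on [neg h], [neg g], [neg f],
    after commuting both connectives on each side. *)
Lemma der_neg_switch f g h : linear (And f (Or g h)) ->
  der (vars (And f (Or g h))) (neg (Or (And f g) h)) (neg (And f (Or g h))).
Proof.
move=> l; set V := vars _; set x1 := neg _; set x4 := neg _.
pose x2 := And (neg h) (Or (neg g) (neg f)); pose x3 := Or (And (neg h) (neg g)) (neg f).
have [V1 V2 V3 V4] : [/\ {subset vars x1 <= V}, {subset vars x2 <= V}, {subset vars x3 <= V} & {subset vars x4 <= V}].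
  by split=> x; rewrite /= !vars_neg !mem_cat; case: (_ \in vars f); case: (_ \in vars g); case: (_ \in vars h).
apply: (der_trans (g := x2)); last apply: (der_trans (g := x3)).
- apply: der_acu => //; apply: acu_trans (acu_ctx_andl (acu_orC _) _ _) (acu_andC _);
    rewrite /linear /= ?vars_neg; cnt.
- by apply: der_step => //; apply: step_switch; rewrite /linear /= ?vars_neg; cnt.
- apply: der_acu => //; apply: acu_trans (acu_orC _) (acu_ctx_orr (acu_andC _) _ _);
    rewrite /linear /= ?vars_neg; cnt.
Qed.

Lemma step_neg f g : step SM f g -> der (vars f) (neg g) (neg f).
Proof.
have ctxl b e h k : der (vars e) (neg h) (neg e) -> linear (op b e k) ->
    der (vars (op b e k)) (neg (op b h k)) (neg (op b e k)).
  move=> d l; have [_ lk] := linear_opI l; rewrite !neg_op vars_op.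
  apply: der_op d _ (linear_op_disj l) _ _; [|exact: subsetl|exact: subsetr].
  by apply: der_refl; rewrite ?linear_neg ?vars_neg.
have ctxr b e h k : der (vars e) (neg h) (neg e) -> linear (op b k e) ->
    der (vars (op b k e)) (neg (op b k h)) (neg (op b k e)).
  move=> d l; have [lk _] := linear_opI l; rewrite !neg_op vars_op.
  apply: der_op _ d (linear_op_disj l) _ _; [|exact: subsetl|exact: subsetr].
  by apply: der_refl; rewrite ?linear_neg ?vars_neg.
elim=> {f g} [l r t [[-> ->]|[-> ->]] l1 l2|f g h _ d l _|f g h _ d l _|f g h _ d l _|f g h _ d l _].
- exact: der_neg_switch.
- apply: der_step; first by apply: step_medial; rewrite /linear /= !vars_neg; cnt.
  by move=> x; rewrite /= !vars_neg !mem_cat; case: (x \in vars (t 0)); case: (x \in vars (t 1)); case: (x \in vars (t 2)); case: (x \in vars (t 3)).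
- exact: ctxl true _ _ _ d l.
- exact: ctxr true _ _ _ d l.
- exact: ctxl false _ _ _ d l.
- exact: ctxr false _ _ _ d l.
Qed.

Lemma der_neg V f g : der V f g -> der V (neg g) (neg f).
Proof.
elim=> {f g} [f g fg fV gV|f g fg fV|f g h _ fg _ gh].
- by apply: der_acu; rewrite ?vars_neg //; apply/acu_neg/acu_sym.
- exact: der_mono fV (step_neg fg).
- exact: der_trans gh fg.
Qed.

(** This is what keeps every linear formula linear under substitution. It serves twice: to return
    from canonical variable names to the original literals, and to erase variables foreign to the
    counterexample. *)
Definition separating (t : nat -> form) : Prop :=
  (forall x, linear (t x)) /\ (forall x y z, z \in vars (t x) -> z \in vars (t y) -> x = y).

Lemma linear_subst t f : separating t -> linear f -> linear (subst t f).
Proof.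
move=> [lt inj]; elim: f => //= [x _|f IHf g IHg|f IHf g IHg]; first by rewrite linear_neg.
all: rewrite /linear /= !cat_uniq => /and3P[/IHf lf /hasPn d /IHg lg]; apply/and3P; split=> //.
all: apply/hasPn=> z; rewrite !vars_subst => /flatten_mapP[x xg zx]; apply/negP => /flatten_mapP[y yf zy].
all: by move: (d x xg); rewrite (inj _ _ _ zx zy) yf.
Qed.

Lemma acu_subst t f g : separating t -> acu f g -> acu (subst t f) (subst t g).
Proof.
move=> st; elim=> {f g} /=.
1: by move=> f lf; apply/acu_refl/linear_subst.
1: by move=> *; apply: acu_sym.
1: by move=> f g h _ ? _ ?; apply: acu_trans; eassumption.
all: intros; first [apply: acu_orC | apply: acu_andC | apply: acu_orA | apply: acu_andA | apply: acu_orB | apply: acu_Bor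
  | apply: acu_andT | apply: acu_Tand | apply: acu_orT | apply: acu_Tor | apply: acu_andB | apply: acu_Band
  | apply: acu_ctx_orl | apply: acu_ctx_orr | apply: acu_ctx_andl | apply: acu_ctx_andr] => //;
  by [apply: linear_subst | apply: (linear_subst (f := And _ _)) | apply: (linear_subst (f := Or _ _))
    | apply: (linear_subst (f := And _ (And _ _))) | apply: (linear_subst (f := Or _ (Or _ _)))].
Qed.

Lemma step_subst t f g : separating t -> step SM f g -> step SM (subst t f) (subst t g).
Proof.
move=> st; elim=> {f g} [l r u lr l1 l2|f g h _ IH l1 l2|f g h _ IH l1 l2|f g h _ IH l1 l2|f g h _ IH l1 l2].
1: by rewrite !subst_comp; apply: step_inst => //; rewrite -subst_comp; apply: linear_subst.
all: move: (linear_subst st l1) (linear_subst st l2) => /= ? ?;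
  first [exact: step_ctx_andl | exact: step_ctx_andr | exact: step_ctx_orl | exact: step_ctx_orr].
Qed.

Lemma der_subst t (V W : seq nat) f g : separating t -> (forall x, x \in V -> {subset vars (t x) <= W}) ->
  der V f g -> der W (subst t f) (subst t g).
Proof.
move=> st VW; have sW h : {subset vars h <= V} -> {subset vars (subst t h) <= W}.
  by move=> hV z; rewrite vars_subst => /flatten_mapP[x /hV xV]; apply: VW.
elim=> {f g} [f g fg fV gV|f g fg fV|f g h _ fg _ gh].
- by apply: der_acu; [apply: acu_subst|apply: sW|apply: sW].
- by apply: der_step; [apply: step_subst|apply: sW].
- exact: der_trans fg gh.
Qed.

(** * Associativity and commutativity *)

Lemma form_op_ind (P : form -> Prop) :
  P Top -> P Bot -> (forall x, P (Var x)) -> (forall x, P (NVar x)) ->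
  (forall b f g, P f -> P g -> P (op b f g)) -> forall f, P f.
Proof.
move=> pT pB pV pN pO; elim=> // [f pf g pg|f pf g pg]; [exact: (pO true)|exact: (pO false)].
Qed.

Lemma eval_op s b f g : eval s (op b f g) = if b then eval s f && eval s g else eval s f || eval s g.
Proof. by case: b. Qed.

(** Unlike [acu], this relation has no linearity conditions and rewrites both arguments at once, so
    inductions stay short. Linearity is an invariant and is supplied once, in [ac_acu]. *)
Inductive ac : form -> form -> Prop :=
| ac_refl f : ac f f
| ac_trans f g h : ac f g -> ac g h -> ac f h
| ac_C b f g : ac (op b f g) (op b g f)
| ac_A b f g h : ac (op b f (op b g h)) (op b (op b f g) h)
| ac_Ar b f g h : ac (op b (op b f g) h) (op b f (op b g h))
| ac_op b f f' g g' : ac f f' -> ac g g' -> ac (op b f g) (op b f' g').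

Lemma ac_sym f g : ac f g -> ac g f.
Proof.
elim=> {f g} [f|f g h _ gf _ hg|b f g|b f g h|b f g h|b f f' g g' _ ? _ ?].
- exact: ac_refl.
- exact: ac_trans hg gf.
- exact: ac_C.
- exact: ac_Ar.
- exact: ac_A.
- exact: ac_op.
Qed.

Lemma ac_vars f g : ac f g -> perm_eq (vars f) (vars g).
Proof.
elim=> {f g} [f|f g h _ fg _|b f g|b f g h|b f g h|b f f' g g' _ ? _ ?]; rewrite ?vars_op //.
- exact: perm_trans.
- by rewrite perm_catC.
- by rewrite catA.
- by rewrite catA.
- exact: perm_cat.
Qed.

Lemma ac_linear f g : ac f g -> linear f = linear g.
Proof. by move/ac_vars/linear_perm. Qed.

Lemma ac_acu f g : ac f g -> linear f -> acu f g.
Proof.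
elim=> {f g} [f|f g h fg IH1 _ IH2 lf|b f g|b f g h|b f g h|b f f' g g' ff IHf gg IHg l].
- exact: acu_refl.
- by apply: acu_trans (IH1 lf) (IH2 _); rewrite -(ac_linear fg).
- exact: acu_opC.
- exact: acu_opA.
- by move=> l; apply/acu_sym/acu_opA; rewrite (ac_linear (ac_A b f g h)).
- have [lf lg] := linear_opI l.
  have l1 : linear (op b f' g) by rewrite -(ac_linear (ac_op b ff (ac_refl g))).
  have l2 : linear (op b f' g') by rewrite -(ac_linear (ac_op b ff gg)).
  apply: acu_trans (acu_opl (IHf lf) l l1) _.
  apply: acu_trans (acu_opC l1) _; apply: acu_sym; apply: acu_trans (acu_opC l2) _.
  have sw h k : linear (op b h k) -> linear (op b k h) by rewrite (ac_linear (ac_C b h k)).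
  by apply: acu_opl (acu_sym (IHg lg)) _ _; apply: sw.
Qed.

Lemma ac_eval f g : ac f g -> forall s, eval s f = eval s g.
Proof.
elim=> {f g} [f|f g h _ IH1 _ IH2|b f g|b f g h|b f g h|b f f' g g' _ IHf _ IHg] s; rewrite ?eval_op ?IH1 ?IH2 ?IHf ?IHg //.
- by case: b; [exact: andbC|exact: orbC].
- by case: b; rewrite ?andbA ?orbA.
- by case: b; rewrite ?andbA ?orbA.
Qed.

Lemma der_ac V f g : ac f g -> linear f -> {subset vars f <= V} -> der V f g.
Proof.
move=> fg lf fV; apply: der_acu => //; first exact: ac_acu.
by move=> x; rewrite -(perm_mem (ac_vars fg)); apply: fV.
Qed.

(** * Unit-free formulae, weight and polarity *)

Fixpoint unit_free f : bool :=
  match f with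
  | Top | Bot => false
  | Var _ | NVar _ => true
  | And f g | Or f g => unit_free f && unit_free g
  end.

Lemma unit_free_op b f g : unit_free (op b f g) = unit_free f && unit_free g.
Proof. by case: b. Qed.

Lemma unit_free_neg f : unit_free (neg f) = unit_free f.
Proof. by elim: f => //= f -> g ->. Qed.

Lemma unit_free_vars f : unit_free f -> 0 < size (vars f).
Proof. by elim/form_op_ind: f => // b f g IHf _; rewrite unit_free_op vars_op size_cat => /andP[/IHf]; lia. Qed.

Lemma ac_unit_free f g : ac f g -> unit_free f = unit_free g.
Proof.
elim=> {f g} [f|f g h _ IH1 _ IH2|b f g|b f g h|b f g h|b f f' g g' _ IHf _ IHg]; rewrite ?unit_free_op ?IH1 ?IHf ?IHg //.
- by rewrite andbC.
- by rewrite andbA.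
- by rewrite andbA.
Qed.

(* The induction measure: it drops when a literal is replaced by a unit and when units are simplified. *)
Fixpoint weight f : nat :=
  match f with
  | Top | Bot => 1
  | Var _ | NVar _ => 2
  | And f g | Or f g => (weight f + weight g).+1
  end.

Lemma weight_op b f g : weight (op b f g) = (weight f + weight g).+1.
Proof. by case: b. Qed.

Lemma weight_neg f : weight (neg f) = weight f.
Proof. by elim: f => //= f -> g ->. Qed.

Lemma weight_gt0 f : 0 < weight f.
Proof. by case: f. Qed.

Lemma ac_weight f g : ac f g -> weight f = weight g.
Proof. by elim=> {f g} *; rewrite ?weight_op; lia. Qed.

(** In a linear formula each variable has a single sign, so one predicate records all signs. Under
    it, the literal of [x] is true at [s] exactly when [q x == s x]. *)
Fixpoint pol (q : pred nat) f : bool :=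
  match f with
  | Top | Bot => true
  | Var x => q x
  | NVar x => ~~ q x
  | And f g | Or f g => pol q f && pol q g
  end.

Lemma pol_op q b f g : pol q (op b f g) = pol q f && pol q g.
Proof. by case: b. Qed.

Lemma ac_pol q f g : ac f g -> pol q f = pol q g.
Proof.
elim=> {f g} [f|f g h _ IH1 _ IH2|b f g|b f g h|b f g h|b f f' g g' _ IHf _ IHg]; rewrite ?pol_op ?IH1 ?IHf ?IHg //.
- by rewrite andbC.
- by rewrite andbA.
- by rewrite andbA.
Qed.

Lemma pol_ext q q' f : {in vars f, q =1 q'} -> pol q f = pol q' f.
Proof.
elim/form_op_ind: f => //= [x|x|b f g IHf IHg] e; rewrite ?e ?inE // !pol_op.
by rewrite IHf ?IHg // => x xf; apply: e; rewrite vars_op mem_cat xf ?orbT.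
Qed.

Lemma pol_neg q f : pol (predC q) (neg f) = pol q f.
Proof. by elim: f => //= [x|f -> g ->|f -> g ->] //; rewrite negbK. Qed.

Lemma linear_pol f : linear f -> exists q, pol q f.
Proof.
elim/form_op_ind: f => [||x|x|b f g IHf IHg l]; [by exists xpredT|by exists xpredT|by exists xpredT|by exists xpred0|].
have [[lf lg] d] := (linear_opI l, linear_op_disj l).
have [[q qf] [q' qg]] := (IHf lf, IHg lg).
exists (fun x => if x \in vars f then q x else q' x); rewrite pol_op; apply/andP; split.
- by rewrite -(pol_ext (q := q)) // => x /= ->.
- by rewrite -(pol_ext (q := q')) // => x /d /= /negbTE ->.
Qed.

Lemma pol_eval_true q f : unit_free f -> pol q f -> eval q f.
Proof. by elim: f => //= f IHf g IHg /andP[uf ug] /andP[pf pg]; rewrite IHf ?IHg. Qed.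

Lemma pol_eval_false q f : unit_free f -> pol q f -> eval (predC q) f = false.
Proof. by move=> uf pf; apply/negbTE; rewrite -eval_neg; apply: pol_eval_true; rewrite ?unit_free_neg ?pol_neg. Qed.

(** Negation occurs only in literals, so a formula is monotone in the truth values of its
    literals. *)
Lemma pol_mono q f s t : pol q f -> {in vars f, forall x, q x == s x -> q x == t x} -> eval s f -> eval t f.
Proof.
elim/form_op_ind: f => //= [x qx /(_ x)|x /negbTE qx /(_ x)|b f g IHf IHg].
- by rewrite inE eqxx qx => H sx; move: (H isT); rewrite sx => /(_ isT) /eqP <-.
- by rewrite inE eqxx qx => H /negbTE sx; move: (H isT); rewrite sx => /(_ isT) /eqP <-.
- rewrite pol_op => /andP[pf pg] H; rewrite !eval_op.
  have {}IHf : eval s f -> eval t f by apply: IHf => // x xf; apply: H; rewrite vars_op mem_cat xf.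
  have {}IHg : eval s g -> eval t g by apply: IHg => // x xf; apply: H; rewrite vars_op mem_cat xf orbT.
  by case: b {H} => [/andP[/IHf-> /IHg->]|/orP[/IHf->|/IHg->]] //; rewrite orbT.
Qed.

(** * Replacing literals by units *)

(** The replacement acts on literals, not on variables: [NVar x] also becomes [Top] when [v] is
    true. So [rep true] always weakens and [rep false] always strengthens, whatever the signs. *)
Fixpoint rep (v : bool) (p : pred nat) f : form :=
  match f with
  | Top => Top
  | Bot => Bot
  | Var x => if p x then if v then Top else Bot else Var x
  | NVar x => if p x then if v then Top else Bot else NVar x
  | And f g => And (rep v p f) (rep v p g)
  | Or f g => Or (rep v p f) (rep v p g)
  end.

Lemma rep_op v p b f g : rep v p (op b f g) = op b (rep v p f) (rep v p g).
Proof. by case: b. Qed.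

Lemma rep_neg v p f : neg (rep v p f) = rep (~~ v) p (neg f).
Proof. by elim: f => //= [x|x|f -> g ->|f -> g ->] //; case: (p x) => //; case: v. Qed.

Lemma vars_rep v p f : vars (rep v p f) = [seq x <- vars f | ~~ p x].
Proof.
by elim: f => //= [x|x|f -> g ->|f -> g ->]; rewrite ?filter_cat //; case: (p x) => //; case: v.
Qed.

Lemma linear_rep v p f : linear f -> linear (rep v p f).
Proof. by rewrite /linear vars_rep; apply: filter_uniq. Qed.

Lemma rep_id v p f : {in vars f, forall x, ~~ p x} -> rep v p f = f.
Proof.
elim/form_op_ind: f => //= [x|x|b f g IHf IHg] H; try by rewrite (negbTE (H x _)) ?inE.
by rewrite rep_op IHf ?IHg // => x xf; apply: H; rewrite vars_op mem_cat xf ?orbT.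
Qed.

Lemma weight_rep_le v p f : weight (rep v p f) <= weight f.
Proof. by elim: f => //= [x|x|f ? g ?|f ? g ?]; [case: (p x); case: v|case: (p x); case: v|lia|lia]. Qed.

Lemma weight_rep_lt v (p : pred nat) x f : x \in vars f -> p x -> weight (rep v p f) < weight f.
Proof.
move=> + px; elim/form_op_ind: f => //= [y|y|b f g IHf IHg].
- by rewrite inE => /eqP<-; rewrite px; case: v.
- by rewrite inE => /eqP<-; rewrite px; case: v.
- rewrite rep_op !weight_op vars_op mem_cat => /orP[/IHf|/IHg]; have := weight_rep_le v p f; have := weight_rep_le v p g; lia.
Qed.

Lemma eval_rep q v p f s : pol q f ->
  eval s (rep v p f) = eval (fun x => if p x then q x == v else s x) f.
Proof.
elim/form_op_ind: f => //= [x qx|x /negbTE qx|b f g IHf IHg].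
- by case: (p x) => //; rewrite qx; case: v.
- by case: (p x) => //; rewrite qx; case: v.
- by rewrite pol_op rep_op !eval_op => /andP[/IHf-> /IHg->].
Qed.

(** [Bot] is [And Bot (Or Top f)], since [Top] absorbs [f]; switch moves [Top] next to [Bot] and
    releases [f]. *)
Lemma der_bot V f : linear f -> {subset vars f <= V} -> der V Bot f.
Proof.
move=> lf fV.
have l1 : linear (And Bot (Or Top f)) by [].
apply: (der_trans (g := And Bot (Or Top f))); first by apply: der_acu => //; apply/acu_sym/acu_Band.
apply: (der_trans (g := Or (And Bot Top) f)); first by apply: der_step => //; apply: step_switch.
apply: der_acu => //; apply: acu_trans (acu_Bor lf).
by apply: acu_ctx_orl => //; apply: acu_andT.
Qed.

Lemma der_top V f : linear f -> {subset vars f <= V} -> der V f Top.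
Proof.
move=> lf fV; rewrite -(negK f) -[Top]/(neg Bot); apply: der_neg.
by apply: der_bot; rewrite ?linear_neg ?vars_neg.
Qed.

Lemma der_rep_true p f : linear f -> der (vars f) f (rep true p f).
Proof.
elim/form_op_ind: f => //= [_|_|x lx|x lx|b f g IHf IHg l]; try exact: der_refl.
- by case: (p x); [apply: der_top|apply: der_refl].
- by case: (p x); [apply: der_top|apply: der_refl].
- have [lf lg] := linear_opI l.
  by rewrite rep_op; apply: der_op_vars => //; [apply: IHf|apply: IHg].
Qed.

Lemma ac_ACA b e f g h : ac (op b (op b e f) (op b g h)) (op b (op b e g) (op b f h)).
Proof.
apply: ac_trans (ac_Ar _ _ _ _) _; apply: ac_trans _ (ac_A _ _ _ _); apply: ac_op; first exact: ac_refl.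
apply: ac_trans (ac_A _ _ _ _) _; apply: ac_trans _ (ac_Ar _ _ _ _); apply: ac_op; last exact: ac_refl.
exact: ac_C.
Qed.

(** A literal receives the conjunct [Top] on the side where it is to vanish, and [Bot] is doubled.
    Two split arguments are regrouped by associativity and commutativity under a conjunction; under
    a disjunction this regrouping is exactly medial. *)
Lemma der_rep_split p f : linear f -> der (vars f) f (And (rep true p f) (rep true (predC p) f)).
Proof.
have lit g : linear g -> der (vars g) g (And Top g).
  by move=> lg; apply: der_acu => //; apply/acu_sym/acu_Tand.
have litr g : linear g -> der (vars g) g (And g Top).
  move=> lg; apply: der_acu => //; first exact/acu_sym/acu_andT.
  by move=> x; rewrite /= cats0.
elim/form_op_ind: f => [_|_|x lx|x lx|b f g IHf IHg l] /=.
- exact: (lit Top).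
- by apply: der_acu => //; apply/acu_sym/acu_andB.
- by case: (p x); [apply: (lit (Var x))|apply: (litr (Var x))].
- by case: (p x); [apply: (lit (NVar x))|apply: (litr (NVar x))].
- have [lf lg] := linear_opI l; rewrite !rep_op.
set f1 := rep _ p f in IHf *; set f2 := rep _ _ f in IHf *.
set g1 := rep _ p g in IHg *; set g2 := rep _ _ g in IHg *.
have d := der_op_vars (IHf lf) (IHg lg) l.
have [[_ l'] [_ s']] := (der_linear d, der_vars d).
apply: der_trans d _; case: b l l' s' => l l' s'.
+ exact: der_ac (ac_ACA true _ _ _ _) l' s'.
+ by apply: der_step => //; apply: step_medial.
Qed.

Definition lit (q : pred nat) x : form := if q x then Var x else NVar x.

Lemma vars_lit q x : vars (lit q x) = [:: x].
Proof. by rewrite /lit; case: (q x). Qed.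

Lemma eval_lit q x s : eval s (lit q x) = (q x == s x).
Proof. by rewrite /lit; case: (q x) => /=; case: (s x). Qed.

(* Repeated switch: a conjunct [x] can be pushed down to the occurrence of [x] below. *)
Lemma der_lit_and q x f : linear f -> pol q f -> x \in vars f ->
  der (vars f) (And (lit q x) (rep true (pred1 x) f)) f.
Proof.
have lv : vars (lit q x) = [:: x] by rewrite vars_lit.
have key b : forall f g, (der (vars f) (And (lit q x) (rep true (pred1 x) f)) f) -> linear (op b f g) ->
    x \in vars f -> der (vars (op b f g)) (And (lit q x) (rep true (pred1 x) (op b f g))) (op b f g).
  move=> {}f g d l xf; have [lf lg] := linear_opI l; have gd := linear_op_disj l.
  have gE : rep true (pred1 x) g = g by apply: rep_id => y /gd; apply: contra => /eqP->.
  rewrite rep_op gE.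
  set f' := rep _ _ f in d *; have [[l' _] [s' _]] := (der_linear d, der_vars d).
  have d2 : der (vars f ++ vars g) (op b (And (lit q x) f') g) (op b f g).
    have dg : der (vars g) g g by apply: der_refl.
    by apply: (der_op b d dg gd) => y yfg; rewrite mem_cat yfg ?orbT.
  rewrite vars_op; apply: der_trans _ d2.
  have s2 : {subset vars (And (lit q x) f') ++ vars g <= vars f ++ vars g}.
    by apply: subset_cat; [move=> y /s'; apply: subsetl|apply: subsetr].
  have l2 := linear_disj b l' lg s' gd.
  (* A conjunction needs only associativity; for a disjunction, switch carries the literal into the
     disjunct that contains [x]. *)
  case: b l l2 => l l2;
    [apply: der_ac (ac_A true _ _ _) _ _|apply: der_step; [apply: step_switch|]];
    by [move: l2; rewrite /linear /= catA|move: s2; rewrite /= catA].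
elim/form_op_ind: f => //= [y ly qy|y ly qy|b f g IHf IHg l].
- rewrite inE => /eqP yx; rewrite -{}yx in qy *; rewrite eqxx /lit qy.
  by apply: der_acu => //; exact: acu_andT.
- rewrite inE => /eqP yx; rewrite -{}yx in qy *; rewrite eqxx /lit (negbTE qy).
  by apply: der_acu => //; exact: acu_andT.
- rewrite pol_op => /andP[qf qg]; rewrite vars_op mem_cat => /orP[xf|xg].
  by rewrite -(vars_op b); apply: key => //; apply: IHf => //; case: (linear_opI l).
have [lf lg] := linear_opI l; have l' : linear (op b g f) by rewrite (ac_linear (ac_C b g f)).
have d := key b g f (IHg lg qg xg) l' xg; have [[ld _] [sd _]] := (der_linear d, der_vars d).
have gf : {subset vars (op b g f) <= vars f ++ vars g} by move=> y; rewrite vars_op !mem_cat orbC.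
apply: (der_trans (g := op b g f)); last by apply: der_ac => //; apply: ac_C.
have {}d := der_mono gf d; have [[ld' _] [sd' _]] := (der_linear d, der_vars d).
rewrite !rep_op in d ld' sd' *; apply: der_trans d; have E := ac_op true (ac_refl (lit q x)) (ac_C b (rep true (pred1 x) f) (rep true (pred1 x) g)).
apply: (der_ac E); first by rewrite (ac_linear E).
by move=> y; rewrite (perm_mem (ac_vars E)); apply: sd'.
Qed.

(** * Simplification of units *)

Definition absorbing (b : bool) : form := if b then Bot else Top.
Definition neutral (b : bool) : form := if b then Top else Bot.

Definition sop b f g : form :=
  if (f == absorbing b) || (g == absorbing b) then absorbing b
  else if f == neutral b then g else if g == neutral b then f else op b f g.

Fixpoint simp f : form :=
  match f with
  | And f g => sop true (simp f) (simp g)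
  | Or f g => sop false (simp f) (simp g)
  | _ => f
  end.

Lemma simp_op b f g : simp (op b f g) = sop b (simp f) (simp g).
Proof. by case: b. Qed.

Variant sop_spec b f g : form -> Type :=
| SopAbsl of f = absorbing b : sop_spec b f g (absorbing b)
| SopAbsr of g = absorbing b : sop_spec b f g (absorbing b)
| SopNeul of f = neutral b & g <> absorbing b : sop_spec b f g g
| SopNeur of g = neutral b & f <> absorbing b : sop_spec b f g f
| SopOp of f <> absorbing b & g <> absorbing b & f <> neutral b & g <> neutral b :
    sop_spec b f g (op b f g).

Lemma sopP b f g : sop_spec b f g (sop b f g).
Proof.
rewrite /sop; case: (f =P _) => [|n1] /=; first by constructor.
case: (g =P _) => [|n2] /=; first by constructor.
case: (f =P _) => [|n3]; first by constructor.
by case: (g =P _) => [|n4]; constructor.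
Qed.

Lemma acu_sop b f g : linear (op b f g) -> acu (op b f g) (sop b f g).
Proof.
move=> l; have [lf lg] := linear_opI l.
case: sopP => [->|->|-> _|-> _|_ _ _ _]; last exact: acu_refl.
all: case: b {l}.
- exact: acu_Band.
- exact: acu_Tor.
- exact: acu_andB.
- exact: acu_orT.
- exact: acu_Tand.
- exact: acu_Bor.
- exact: acu_andT.
- exact: acu_orB.
Qed.

Lemma vars_absorbing b : vars (absorbing b) = [::].
Proof. by case: b. Qed.

(** Counting with an arbitrary predicate yields at once inclusion of variables, linearity, size
    bounds and the bound on shared variables. *)
Lemma count_vars_simp (p : pred nat) f : count p (vars (simp f)) <= count p (vars f).
Proof.
elim/form_op_ind: f => // b f g IHf IHg; rewrite simp_op vars_op count_cat.
by case: sopP => *; rewrite ?vars_absorbing ?vars_op ?count_cat /=; lia.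
Qed.

Lemma vars_simp f : {subset vars (simp f) <= vars f}.
Proof.
by move=> x; rewrite -!has_pred1 !has_count => /leq_trans; apply; apply: count_vars_simp.
Qed.

Lemma linear_simp f : linear f -> linear (simp f).
Proof.
by move/linearP => l; apply/linearP => x; apply: leq_trans (l x); apply: count_vars_simp.
Qed.

Lemma acu_simp f : linear f -> acu f (simp f).
Proof.
elim/form_op_ind: f => [l|l|x l|x l|b f g IHf IHg l]; try exact: acu_refl.
have [lf lg] := linear_opI l; rewrite simp_op.
move/linearP: (l) => c1.
have l1 : linear (op b (simp f) (simp g)).
  by apply/linearP => x; apply: leq_trans (c1 x); rewrite !vars_op !count_cat leq_add ?count_vars_simp.
have l2 : linear (op b (simp f) g).
  by apply/linearP => x; apply: leq_trans (c1 x); rewrite !vars_op !count_cat leq_add ?count_vars_simp.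
apply: acu_trans (acu_sop l1); apply: acu_trans (acu_opl (IHf lf) l l2) _.
have sw h k : linear (op b h k) -> linear (op b k h) by rewrite (ac_linear (ac_C b h k)).
apply: acu_trans (acu_opC l2) _; apply: acu_trans _ (acu_opC (sw _ _ l1)).
by apply: acu_opl (IHg lg) _ _; apply: sw.
Qed.

Lemma eval_simp s f : eval s (simp f) = eval s f.
Proof.
elim/form_op_ind: f => // b f g IHf IHg; rewrite simp_op eval_op -IHf -IHg.
by case: sopP => [->|->|-> _|-> _|_ _ _ _]; case: b; rewrite /= ?andbF ?orbT ?andbT ?orbF.
Qed.

Lemma simp_normal f : [\/ simp f = Top, simp f = Bot | unit_free (simp f)].
Proof.
elim/form_op_ind: f => [||x|x|b f g IHf IHg]; try by constructor.
rewrite simp_op; case: sopP => // [_|_|nf ng nf' ng'].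
- by case: b; constructor.
- by case: b; constructor.
- apply: Or33; rewrite unit_free_op.
  case: IHf => [E|E|->]; case: IHg => [E'|E'|->] //; by case: b nf ng nf' ng'; rewrite ?E ?E'.
Qed.

Lemma weight_simp f : simp f = f \/ weight (simp f) < weight f.
Proof.
elim/form_op_ind: f => [||x|x|b f g IHf IHg]; try by left.
rewrite simp_op weight_op.
have := weight_gt0 f; have := weight_gt0 g.
have wa : weight (absorbing b) = 1 by case: b.
case: sopP => [fE|gE|fE _|gE _|_ _ _ _]; last first.
- case: IHf => [->|lf]; case: IHg => [->|lg]; [by left|right|right|right]; rewrite ?weight_op; lia.
- case: IHf => [E|lf]; right; rewrite ?E; lia.
- case: IHg => [E|lf]; right; rewrite ?E; lia.
- by right; rewrite wa; lia.
- by right; rewrite wa; lia.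
Qed.

(** * Reductions to smaller inferences *)

(** [V] is arbitrary so that a reduction can confine its subderivations to disjoint sets and then
    combine them by [der_op]. *)
Definition goal f g : Prop :=
  linear f -> linear g -> le f g -> count (mem (vars g)) (vars f) <= 7 ->
  forall V : seq nat, {subset vars f <= V} -> {subset vars g <= V} -> der V f g.

Lemma count_mem_sym (s t : seq nat) : uniq s -> uniq t -> count (mem s) t = count (mem t) s.
Proof.
move=> us ut; rewrite -!size_filter; apply/perm_size/uniq_perm; rewrite ?filter_uniq //.
by move=> x; rewrite !mem_filter /= andbC.
Qed.

(** Contraposition gives every reduction its mirror image. The count of shared variables is taken
    from the other side, which linearity makes equal. *)
Lemma goal_neg f g : goal (neg g) (neg f) -> goal f g.
Proof.
move=> G lf lg fg c V fV gV; rewrite -(negK f) -(negK g); apply: der_neg; apply: G.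
- by rewrite linear_neg.
- by rewrite linear_neg.
- exact: le_neg.
- by rewrite !vars_neg count_mem_sym.
- by rewrite vars_neg.
- by rewrite vars_neg.
Qed.

Lemma goal_and f g h :
  (forall f' g', weight f' + weight g' < weight f + weight (And g h) -> goal f' g') ->
  goal f (And g h).
Proof.
move=> IH lf lgh fgh c V fV gV.
have [[lg lh] /= d] := (linear_and lgh, @linear_op_disj true _ _ lgh).
have [q qf] := linear_pol lf.
(* Variables of [f] in neither [g] nor [h] also satisfy [p]: they vanish from the copy that derives
   [g] and survive in the copy for [h], whose set [Vh] contains them. *)
pose p : pred nat := fun x => x \notin vars g.
have pC : predC p =1 mem (vars g) by move=> x; rewrite /p /= negbK.
pose Vg := [seq x <- V | x \in vars g]; pose Vh := [seq x <- V | x \notin vars g].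
have dg : der Vg (rep true p f) g.
{ apply: IH.
  - by rewrite /=; have := weight_rep_le true p f; lia.
  - exact: linear_rep.
  - by [].
  - move=> s; rewrite (eval_rep _ _ _ qf) => /fgh /= /andP[+ _].
    by rewrite (eval_ext (t := s)) // => x xg; rewrite /p xg.
  - rewrite vars_rep count_filter; apply: leq_trans c; apply: sub_count => x /= /andP[xg _].
    by rewrite mem_cat xg.
  - by move=> x; rewrite vars_rep !mem_filter negbK => /andP[-> /fV].
  - by move=> x xg; rewrite mem_filter xg; apply: gV; rewrite /= mem_cat xg. }
have dh : der Vh (rep true (predC p) f) h.
{ apply: IH.
  - by rewrite /=; have := weight_rep_le true (predC p) f; lia.
  - exact: linear_rep.
  - by [].
  - move=> s; rewrite (eval_rep _ _ _ qf) => /fgh /= /andP[_].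
    by rewrite (eval_ext (t := s)) // => x /d xg; rewrite /p negbK /= (negbTE xg).
  - rewrite vars_rep count_filter; apply: leq_trans c; apply: sub_count => x /= /andP[xg _].
    by rewrite mem_cat xg orbT.
  - by move=> x; rewrite vars_rep !mem_filter /= negbK => /andP[px /fV ->]; rewrite andbT.
  - by move=> x xh; rewrite mem_filter (d x xh); apply: gV; rewrite /= mem_cat xh orbT. }
apply: der_trans (der_mono fV (der_rep_split p lf)) _.
apply: (der_op true dg dh) => x; rewrite !mem_filter; try by case/andP.
by case/andP=> /negbTE->.
Qed.

Lemma goal_or f g h :
  (forall f' g', weight f' + weight g' < weight (Or f g) + weight h -> goal f' g') ->
  goal (Or f g) h.
Proof.
move=> IH; apply: goal_neg; apply: goal_and => f' g' w; apply: goal_neg; apply: IH.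
by move: w; rewrite /= !weight_neg; lia.
Qed.

(** The weakened [f] is [f] at the assignment that makes its literal of [x] true. There [g] holds;
    going back to [s] can only make literals of [g] true, since [x] has the opposite sign in [g] or
    is absent. *)
Lemma le_rep q q' x f g : pol q f -> pol q' g -> le f g -> (x \in vars g -> q' x != q x) ->
  le (rep true (pred1 x) f) g.
Proof.
move=> qf qg fg qx s; rewrite (eval_rep _ _ _ qf) => /fg.
apply: (pol_mono qg) => y yg /=; case: (y =P x) => // yx.
by move: qx; rewrite -yx => /(_ yg); case: (q y); case: (q' y).
Qed.

Lemma goal_rep x f g :
  (forall f' g', weight f' + weight g' < weight f + weight g -> goal f' g') ->
  x \in vars f -> le (rep true (pred1 x) f) g -> goal f g.
Proof.
move=> IH xf fg lf lg _ c V fV gV.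
apply: der_trans (der_mono fV (der_rep_true (pred1 x) lf)) _; apply: IH => //.
- by rewrite ltn_add2r; apply: weight_rep_lt xf _ => /=.
- exact: linear_rep.
- by rewrite vars_rep count_filter; apply: leq_trans c; apply: sub_count => y /andP[].
- by move=> y; rewrite vars_rep mem_filter => /andP[_ /fV].
Qed.

Lemma goal_rep_r x f g :
  (forall f' g', weight f' + weight g' < weight f + weight g -> goal f' g') ->
  x \in vars g -> le f (rep false (pred1 x) g) -> goal f g.
Proof.
move=> IH xg fg; apply: goal_neg; apply: (goal_rep (x := x)).
- by move=> f' g' w; apply: goal_neg; apply: IH; move: w; rewrite !weight_neg; lia.
- by rewrite vars_neg.
- by rewrite -[rep _ _ _]negK rep_neg negK; apply: le_neg.
Qed.

(** * Arguments of the root connective up to associativity *)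

Definition rooted b f : bool :=
  match f with
  | And _ _ => b
  | Or _ _ => ~~ b
  | _ => false
  end.

Lemma rooted_op b c f g : rooted b (op c f g) = (b == c).
Proof. by case: b; case: c. Qed.

Lemma rooted_neg b f : rooted b (neg f) = rooted (~~ b) f.
Proof. by case: f => //= *; rewrite negbK. Qed.

Lemma rootedP b f : rooted b f -> exists g h, f = op b g h.
Proof. by case: f => // g h; case: b => // _; exists g, h. Qed.

Fixpoint parts (b : bool) f : seq form :=
  match f with
  | And g h => if b then parts b g ++ parts b h else [:: f]
  | Or g h => if b then [:: f] else parts b g ++ parts b h
  | _ => [:: f]
  end.

Lemma parts_op b f g : parts b (op b f g) = parts b f ++ parts b g.
Proof. by case: b. Qed.

Lemma parts_other b f : ~~ rooted b f -> parts b f = [:: f].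
Proof. by case: b; case: f. Qed.

Lemma parts_neg b f : parts b (neg f) = [seq neg g | g <- parts (~~ b) f].
Proof.
by case: b; elim: f => //= f IHf g IHg; rewrite map_cat IHf IHg.
Qed.

Lemma parts_rooted b f g : g \in parts b f -> ~~ rooted b g.
Proof.
elim/form_op_ind: f => [||x|x|c f h IHf IHh]; try by case: b; rewrite inE => /eqP->.
case: (b =P c) => [<-|bc]; first by rewrite parts_op mem_cat => /orP[].
by rewrite parts_other ?rooted_op ?inE => [/eqP->|]; rewrite ?rooted_op; apply/eqP.
Qed.

Lemma parts_extract b f g : rooted b f -> g \in parts b f -> exists h, ac f (op b g h).
Proof.
have key h : g \in parts b h -> g = h \/ exists k, ac h (op b g k).
{ elim/form_op_ind: h => [||x|x|c h h' IH IH']; try by case: b; rewrite inE => /eqP->; left.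
  case: (b =P c) => [<-|/eqP bc]; last first.
    by rewrite parts_other ?rooted_op // inE => /eqP->; left.
  rewrite parts_op mem_cat => /orP[/IH|/IH'] [->|[k gk]]; right.
  - by exists h'; apply: ac_refl.
  - exists (op b k h'); apply: ac_trans _ (ac_Ar _ _ _ _); exact: ac_op gk (ac_refl _).
  - by exists h; apply: ac_C.
  - exists (op b k h); apply: ac_trans (ac_C _ _ _) _; apply: ac_trans _ (ac_Ar _ _ _ _).
    exact: ac_op gk (ac_refl _). }
move=> rf gf; case: (key _ gf) => // gE; have := parts_rooted gf; by rewrite gE rf.
Qed.

Lemma lit_of q f : unit_free f -> pol q f -> size (vars f) <= 1 -> exists x, f = lit q x.
Proof.
case: f => //= [x _ qx _|x _ /negbTE qx _|f g|f g]; try by exists x; rewrite /lit qx.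
all: by move=> /andP[/unit_free_vars + /unit_free_vars]; rewrite size_cat; lia.
Qed.

Lemma parts_unit_free b f g : unit_free f -> g \in parts b f -> unit_free g.
Proof.
elim/form_op_ind: f => [||x|x|c f h IHf IHh] //; try by case: b; rewrite inE => ? /eqP->.
case: (b =P c) => [<-|/eqP bc u].
  by rewrite unit_free_op parts_op mem_cat => /andP[? ?] /orP[]; auto.
by rewrite parts_other ?rooted_op // inE => /eqP->.
Qed.

Lemma goal_literal_part q f g c :
  (forall f' g', weight f' + weight g' < weight f + weight g -> goal f' g') ->
  unit_free f -> pol q f -> pol q g -> vars f =i vars g ->
  rooted true f -> c \in parts true f -> size (vars c) <= 1 -> goal f g.
Proof.
move=> IH uf qf qg fg rf cf c1 lf lg lefg k V fV gV.
have [r fr] := parts_extract rf cf.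
have [qc qr] : pol q c /\ pol q r by apply/andP; rewrite -(pol_op q true) -(ac_pol _ fr).
have [uc ur] : unit_free c /\ unit_free r by apply/andP; rewrite -(unit_free_op true) -(ac_unit_free fr).
have [x cE] := lit_of uc qc c1.
have l2 : linear (And c r) by rewrite -(ac_linear fr).
have [lc lr] := linear_and l2.
have xf : x \in vars f by rewrite (perm_mem (ac_vars fr)) vars_op mem_cat cE vars_lit inE eqxx.
have xg : x \in vars g by rewrite -fg.
have rx : {in vars r, forall y, y != x}.
  by move=> y /(linear_op_disj (b := true) l2); rewrite cE vars_lit inE.
have rf' : {subset vars r <= vars f}.
  by move=> y; rewrite (perm_mem (ac_vars fr)) vars_op mem_cat orbC => ->.
(* Keeping [x] out of this derivation allows it to be placed under a conjunction with the literal
   [c]. *)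
pose W := [seq y <- V | y != x].
have d : der W r (rep true (pred1 x) g).
{ apply: IH.
  - by move: (weight_rep_le true (pred1 x) g) (weight_gt0 c); rewrite (ac_weight fr) weight_op; clear; lia.
  - by [].
  - exact: linear_rep.
  - move=> s rs; rewrite (eval_rep _ _ _ qg); apply: lefg.
    rewrite (ac_eval fr) /= cE eval_lit eqxx eqb_id eqxx /=.
    by rewrite -(eval_ext (s := s)) // => y /rx /negbTE ->.
  - rewrite vars_rep; apply: leq_trans k; rewrite (permP (ac_vars fr)) vars_op count_cat.
    apply: leq_trans (leq_addl _ _); apply: sub_count => y /=.
    by rewrite mem_filter => /andP[].
  - by move=> y yr; rewrite mem_filter (rx y yr) fV // rf'.
  - by move=> y; rewrite vars_rep !mem_filter => /andP[-> /gV]. }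
apply: der_trans (der_ac fr lf fV) _; apply: (der_trans (g := And c (rep true (pred1 x) g))).
{ have dc : der [:: x] c c by apply: der_refl => //; rewrite cE vars_lit.
  apply: (der_op true dc d).
  - by move=> y; rewrite mem_filter inE => /andP[].
  - by move=> y; rewrite inE => /eqP->; apply: gV.
  - by move=> y; rewrite mem_filter => /andP[]. }
by rewrite cE; apply: der_mono gV (der_lit_and lg qg xg).
Qed.

Lemma goal_literal_part_r q f g c :
  (forall f' g', weight f' + weight g' < weight f + weight g -> goal f' g') ->
  unit_free g -> pol q f -> pol q g -> vars f =i vars g ->
  rooted false g -> c \in parts false g -> size (vars c) <= 1 -> goal f g.
Proof.
move=> IH ug qf qg fg rg cg c1; apply: goal_neg.
apply: (@goal_literal_part (predC q) _ _ (neg c)); rewrite ?vars_neg ?pol_neg ?unit_free_neg //.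
- by move=> f' g' w; apply: goal_neg; apply: IH; move: w; rewrite !weight_neg; lia.
- by rewrite rooted_neg.
- by rewrite parts_neg; apply: map_f.
Qed.

(* Switch turns [(a \/ r) /\ k] into [a \/ (r /\ k)]; both disjuncts imply [g], and [goal_or] applies. *)
Lemma goal_switch f g c a :
  (forall f' g', weight f' + weight g' < weight f + weight g -> goal f' g') ->
  rooted true f -> c \in parts true f -> rooted false c -> a \in parts false c -> le a g -> goal f g.
Proof.
move=> IH rf cf rc ac_ ag lf lg lefg k V fV gV.
have [h fh] := parts_extract rf cf; have [r cr] := parts_extract rc ac_.
have E : ac f (And h (Or r a)).
  apply: ac_trans fh _; apply: ac_trans (ac_C true _ _) _; apply: (ac_op true (ac_refl _)).
  by apply: ac_trans cr _; apply: (ac_C false).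
have l : linear (And h (Or r a)) by rewrite -(ac_linear E).
have st := step_switch l; have [_ l'] := step_linear st.
apply: der_trans (der_ac E lf fV) _.
have hV : {subset vars (And h (Or r a)) <= V} by move=> y; rewrite -(perm_mem (ac_vars E)); apply: fV.
apply: der_trans (der_step st hV) _.
have P : perm_eq (vars f) (vars (Or (And h r) a)) by apply: perm_trans (ac_vars E) (step_vars st).
apply: goal_or => //.
(* Switch preserves the weight, so the induction hypothesis for [f] also covers what is smaller than
   the new disjunction. *)
- by move=> f' g' w; apply: IH; rewrite (ac_weight E); move: w => /=; lia.
- move=> s /= /orP[/andP[hs rs]|]; last exact: ag.
  by apply: lefg; rewrite (ac_eval E) /= hs rs.
- by rewrite -(permP P).
- by move=> y; rewrite -(perm_mem P); apply: fV.
Qed.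

Lemma goal_switch_r f g c a :
  (forall f' g', weight f' + weight g' < weight f + weight g -> goal f' g') ->
  rooted false g -> c \in parts false g -> rooted true c -> a \in parts true c -> le f a -> goal f g.
Proof.
move=> IH rg cg rc ac_ fa; apply: goal_neg; apply: (@goal_switch _ _ (neg c) (neg a)).
- by move=> f' g' w; apply: goal_neg; apply: IH; move: w; rewrite !weight_neg; lia.
- by rewrite rooted_neg.
- by rewrite parts_neg; apply: map_f.
- by rewrite rooted_neg.
- by rewrite parts_neg; apply: map_f.
- exact: le_neg.
Qed.

(** * The finite check *)

(** A lone variable is enumerated under both root connectives; the test on [k] prevents listing it
    twice. *)
Definition join (T : Type) b (k : nat) (F : bool -> seq T) : seq T :=
  if k == 1 then F b else F b ++ F (~~ b).

(** With [k] equal to 2 this excludes literal arguments, which the literal reductions handle. With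
    [k] the size of the preceding argument it sorts arguments in [shapes]. *)
Definition parts_geq b k f : bool := all (fun c => k <= size (vars c)) (parts b f).

(* Formulae with root connective [b] (or a single variable) on the variables [i, ..., i + m - 1]
   in this order, with the arguments of a connective sorted by size. *)
Fixpoint shapes n b i m : seq form :=
  if m == 1 then [:: Var i] else
  if n is n'.+1 then
    flatten [seq let gs := [seq g <- join b (m - k) (fun c => shapes n' c (i + k) (m - k)) | parts_geq b k g] in
                 [seq op b f g | f <- shapes n' (~~ b) i k, g <- gs]
            | k <- iota 1 m.-1]
  else [::].

Fixpoint splits (s : seq nat) : seq (seq nat * seq nat) :=
  if s is x :: s' then flatten [seq [:: (x :: p.1, p.2); (p.1, x :: p.2)] | p <- splits s']
  else [:: ([::], [::])].

(* Formulae with root connective [b] (or a single variable) whose variables are exactly [s];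
   the first argument of a connective carries the least variable. *)
Fixpoint trees n b (s : seq nat) : seq form :=
  if s is x :: s' then
    if s' is [::] then [:: Var x] else
    if n is n'.+1 then
      flatten [seq let gs := join b (size p.2) (fun c => trees n' c p.2) in
                   [seq op b f g | f <- trees n' (~~ b) (x :: p.1), g <- gs]
              | p <- splits s']
    else [::]
  else [::].

(** Union of two sets of variables given as bit lists, where missing positions count as false. *)
Fixpoint or_mask (s t : seq bool) : seq bool :=
  match s, t with
  | x :: s', y :: t' => (if x then true else y) :: or_mask s' t'
  | [::], _ => t
  | _, [::] => s
  end.

(** For a positive formula, these are satisfying sets of variables, one of which lies inside every
    satisfying assignment. [NVar] may get none because only positive formulae are tested. *)
Fixpoint minterms f : seq (seq bool) :=
  match f with
  | Top => [:: [::]]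
  | Bot | NVar _ => [::]
  | Var x => [:: ncons x false [:: true]]
  | And f g => [seq or_mask s t | s <- minterms f, t <- minterms g]
  | Or f g => minterms f ++ minterms g
  end.

Definition implied (ms : seq (seq bool)) f : bool := all (fun m => eval (nth false m) f) ms.

(** [ms] stands for [phi], and [ds] for the disjuncts of its conjuncts, both computed once per
    [phi]. Pairs that are not inferences pass trivially. Conditionals stop the evaluation at the
    first decisive test. *)
Definition reducible (ms : seq (seq bool)) (ds : seq (seq (seq bool))) g : bool :=
  if implied ms g then
    if has (fun d => implied d g) ds then true
    else has (fun c => has (implied ms) (parts true c)) (parts false g)
  else true.

Definition check n : bool :=
  let gs := [seq g <- trees n false (iota 0 n) | parts_geq false 2 g] in
  all (fun f =>
         let ms := minterms f in
         let ds := flatten [seq map minterms (parts false c) | c <- parts true f] in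
         all (reducible ms ds) gs)
      [seq f <- shapes n true 0 n | parts_geq true 2 f].

Lemma check_le7 n : n <= 7 -> check n.
Proof.
(* The only step that depends on the value 7: all other reductions merely pass the bound on. *)
have : all check (iota 0 8) by vm_cast_no_check (erefl true).
by move/allP=> c n7; apply: c; rewrite mem_iota.
Qed.

(** * Completeness of the enumerations *)

Lemma parts_geq_op b c k f g :
  parts_geq b k (op c f g) =
  if b == c then parts_geq b k f && parts_geq b k g else k <= size (vars f) + size (vars g).
Proof.
case: eqP => [<-|/eqP bc]; first by rewrite /parts_geq parts_op all_cat.
by rewrite /parts_geq parts_other ?rooted_op //= andbT vars_op size_cat.
Qed.

Lemma ac_parts_geq b k f g : ac f g -> parts_geq b k f = parts_geq b k g.
Proof.
elim=> {f g} [f|f g h _ -> _ ->|c f g|c f g h|c f g h|c f f' g g' ff E1 gg E2] //; rewrite !parts_geq_op.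
- by rewrite andbC addnC.
- by case: eqP; rewrite ?vars_op ?size_cat ?andbA ?addnA.
- by case: eqP; rewrite ?vars_op ?size_cat ?andbA ?addnA.
- by rewrite E1 E2 (perm_size (ac_vars ff)) (perm_size (ac_vars gg)).
Qed.

Lemma parts_pol q b f g : pol q f -> g \in parts b f -> pol q g.
Proof.
elim/form_op_ind: f => [||x|x|c f h IHf IHh] p; try by case: b; rewrite inE => /eqP->.
move: (p); rewrite pol_op => /andP[pf ph].
case: (b =P c) => [<-|/eqP bc]; first by rewrite parts_op mem_cat => /orP[]; auto.
by rewrite parts_other ?rooted_op // inE => /eqP->.
Qed.

Lemma parts_smallest b f : exists2 c, c \in parts b f & parts_geq b (size (vars c)) f.
Proof.
rewrite /parts_geq; have: parts b f != [::].
  by elim: f => //= f IHf g IHg; case: b IHf IHg => // IHf _; case: parts IHf.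
elim: (parts b f) => // c s IH _; case: s IH => [_|d s /(_ isT)[e es le]].
  by exists c; rewrite ?inE //= leqnn.
case: (leqP (size (vars c)) (size (vars e))) => ce; last first.
  by exists e; [rewrite inE es orbT|apply/andP; split=> //; apply: ltnW].
exists c; first by rewrite inE eqxx.
by rewrite /= leqnn; apply: sub_all le => x; apply: leq_trans.
Qed.

Lemma unit_free_rooted b f : unit_free f -> 1 < size (vars f) -> ~~ rooted (~~ b) f -> rooted b f.
Proof. by case: b; case: f. Qed.

Lemma mem_join (T : eqType) b k (F : bool -> seq T) (x : T) c :
  (k == 1 -> c = b) -> x \in F c -> x \in join b k F.
Proof.
rewrite /join; case: eqP => [_ /(_ isT)-> //|_ _ xc]; rewrite mem_cat.
by case: (c =P b) xc => [->|] => [->|] //; case: c; case: b => // _ ->; rewrite orbT.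
Qed.

(** A lone variable is rooted in neither connective; the second clause picks for it the value under
    which [join] lists it. *)
Lemma shape_root b f : unit_free f -> exists2 c, ~~ rooted (~~ c) f & size (vars f) == 1 -> c = b.
Proof.
move=> uf; case rf: (rooted (~~ b) f); last by exists b; rewrite ?rf.
exists (~~ b); first by move/rootedP: rf => [g [h ->]]; rewrite rooted_op; case: b.
move/rootedP: rf uf => [g [h ->]]; rewrite unit_free_op vars_op size_cat => /andP[/unit_free_vars + /unit_free_vars].
by lia.
Qed.

(** By symmetry the variables on the left may be numbered in order of occurrence, so only the shape
    of [phi] is enumerated; [psi] must then range over all trees on these variables. *)
Fixpoint relabel i f : form :=
  match f with
  | Top => Top
  | Bot => Bot
  | Var _ | NVar _ => Var i
  | And f g => And (relabel i f) (relabel (i + size (vars f)) g)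
  | Or f g => Or (relabel i f) (relabel (i + size (vars f)) g)
  end.

Lemma relabel_op i b f g : relabel i (op b f g) = op b (relabel i f) (relabel (i + size (vars f)) g).
Proof. by case: b. Qed.

Lemma vars_relabel i f : vars (relabel i f) = iota i (size (vars f)).
Proof. by elim/form_op_ind: f i => // b f g IHf IHg i; rewrite relabel_op !vars_op IHf IHg size_cat iotaD. Qed.

Lemma parts_geq_relabel b k i f : parts_geq b k (relabel i f) = parts_geq b k f.
Proof.
elim/form_op_ind: f i => [||x|x|c f g IHf IHg] i; try by case: b.
by rewrite relabel_op !parts_geq_op IHf IHg !vars_relabel !size_iota.
Qed.

(** Moving a smallest part to the front and recursing on the rest sorts the arguments. The
    representative is chosen before the offset [i], which depends on what stands to its left. *)
Lemma shapes_complete n b f : size (vars f) <= n -> unit_free f -> ~~ rooted (~~ b) f ->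
  exists2 g, ac f g & forall i, relabel i g \in shapes n b i (size (vars f)).
Proof.
elim: n b f => [|n IH] b f fn uf rf; first by have := unit_free_vars uf; lia.
case: (leqP (size (vars f)) 1) => [f1|f2].
{ exists f => [|i]; first exact: ac_refl.
  have -> : size (vars f) = 1 by have := unit_free_vars uf; lia.
  case: f uf f1 {rf fn} => //= [x _ _|x _ _|g h|g h]; rewrite ?inE //.
  all: by move=> /andP[/unit_free_vars + /unit_free_vars]; rewrite size_cat; lia. }
have {}rf := unit_free_rooted uf f2 rf.
have [c cf cmin] := parts_smallest b f.
have [r fr] := parts_extract rf cf.
have := uf; rewrite (ac_unit_free fr) unit_free_op => /andP[uc ur].
have sE : size (vars f) = size (vars c) + size (vars r) by rewrite (perm_size (ac_vars fr)) vars_op size_cat.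
have [c0 r0] := (unit_free_vars uc, unit_free_vars ur).
have [c' cc cs] : exists2 g, ac c g & forall i, relabel i g \in shapes n (~~ b) i (size (vars c)).
  by apply: IH => //; [lia|rewrite negbK; apply: parts_rooted cf].
have [d rd d1] := shape_root b ur.
have [r' rr rs] : exists2 g, ac r g & forall i, relabel i g \in shapes n d i (size (vars r)).
  by apply: IH => //; lia.
exists (op b c' r') => [|i]; first by apply: ac_trans fr _; apply: ac_op.
rewrite relabel_op /= ifF; last by apply/eqP; lia.
apply/flatten_mapP; exists (size (vars c)); first by rewrite mem_iota; lia.
rewrite -(perm_size (ac_vars cc)); apply: allpairs_f; rewrite ?cs // mem_filter.
have -> : size (vars f) - size (vars c) = size (vars r) by lia.
rewrite parts_geq_relabel -(ac_parts_geq _ _ rr); apply/andP; split.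
  by move: cmin; rewrite (ac_parts_geq _ _ fr) parts_geq_op eqxx => /andP[].
exact: mem_join d1 (rs _).
Qed.

Lemma filter_splits (p : pred nat) s : ([seq x <- s | p x], [seq x <- s | ~~ p x]) \in splits s.
Proof.
elim: s => // x s IH /=; apply/flatten_mapP; exists ([seq x <- s | p x], [seq x <- s | ~~ p x]) => //.
by rewrite !inE; case: (p x); rewrite eqxx ?orbT.
Qed.

(** The part containing the head of [s] is moved to the front and the rest is treated recursively.
    The named variable breaks the symmetry between parts, so sizes need not be compared. *)
Lemma trees_complete n b f s : size s <= n -> uniq s -> perm_eq (vars f) s -> unit_free f -> pol xpredT f ->
  ~~ rooted (~~ b) f -> exists2 g, ac f g & g \in trees n b s.
Proof.
elim: n b f s => [|n IH] b f s sn us fs uf pf rf.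
  by have := unit_free_vars uf; rewrite (perm_size fs); lia.
case: s sn us fs => [|x s] sn us fs; first by have := unit_free_vars uf; rewrite (perm_size fs).
case: s sn us fs => [|y s] sn us fs.
  have [z fE] : exists z, f = lit xpredT z by apply: lit_of; rewrite ?(perm_size fs).
  exists f; first exact: ac_refl.
  by move/perm_mem: fs => /(_ z); rewrite fE vars_lit !inE eqxx => /esym/eqP->.
(* Naming the nonempty tail keeps the [match] in [trees] folded until [SE] is used. *)
have [S SE] : exists S, S = y :: s by exists (y :: s).
rewrite -SE in sn us fs *.
have f2 : 1 < size (vars f) by rewrite (perm_size fs) SE.
have {}rf := unit_free_rooted uf f2 rf.
have [c cf xc] : exists2 c, c \in parts b f & x \in vars c.
  have : x \in vars f by rewrite (perm_mem fs) inE eqxx.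
  elim/form_op_ind: f {IH fs uf pf f2 rf} => [||z|z|d f g IHf IHg] // xf;
    try by [exists (Var z); rewrite // parts_other ?inE; case: b | exists (NVar z); rewrite // parts_other ?inE; case: b].
  case: (b =P d) => [<-|/eqP bd]; last by exists (op d f g); rewrite // parts_other ?rooted_op ?inE.
  move: xf; rewrite vars_op mem_cat => /orP[/IHf|/IHg] [c cs xc]; exists c;
    by rewrite // parts_op mem_cat cs ?orbT.
have [r fr] := parts_extract rf cf.
have lf : linear (op b c r) by rewrite -(ac_linear fr) /linear (perm_uniq fs).
have [lc lr] := linear_opI lf.
have := uf; rewrite (ac_unit_free fr) unit_free_op => /andP[uc ur].
have := pf; rewrite (ac_pol _ fr) pol_op => /andP[pc pr].
pose p : pred nat := mem (vars c).
have memS z : (z \in x :: S) = (z \in vars c) || (z \in vars r).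
  by rewrite -(perm_mem fs) (perm_mem (ac_vars fr)) vars_op mem_cat.
have xS : x \notin S by case/andP: us.
have uS : uniq S by case/andP: us.
have rc := linear_op_disj lf.
have cS : perm_eq (vars c) (x :: [seq z <- S | p z]).
  apply: uniq_perm => //; first by rewrite /= mem_filter negb_and xS orbT filter_uniq.
  move=> z; rewrite inE mem_filter /p /=; have := memS z; rewrite inE.
  case: (z =P x) => [->|_] /=; first by rewrite xc.
  by move=> ->; have := rc z; case: (z \in vars c); case: (z \in vars r) => // /(_ isT).
have rS : perm_eq (vars r) [seq z <- S | ~~ p z].
  apply: uniq_perm => //; first by rewrite filter_uniq.
  move=> z; rewrite mem_filter /p /=; have := memS z; rewrite inE; have := rc z.
  case: (z =P x) => [->|_]; first by rewrite xc; case: (x \in vars r) => // /(_ isT).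
  case: (z \in vars r) => [/(_ isT)/negbTE->|_] /=; first by move=> ->.
  by rewrite orbF => ->; case: (z \in vars c).
have sS : size (vars f) = (size S).+1 by rewrite (perm_size fs).
have sE : size (vars f) = size (vars c) + size (vars r) by rewrite (perm_size (ac_vars fr)) vars_op size_cat.
have [c0 r0] := (unit_free_vars uc, unit_free_vars ur).
have Sn : size S <= n by [].
have [c' cc cs] : exists2 g, ac c g & g \in trees n (~~ b) (x :: [seq z <- S | p z]).
{ apply: (IH (~~ b) c _ _ _ cS uc pc).
  - by rewrite -(perm_size cS) (leq_trans _ Sn) // -ltnS -sS sE -addn1 leq_add2l.
  - by rewrite -(perm_uniq cS).
  - by rewrite negbK; apply: parts_rooted cf. }
have [d rd d1] := shape_root b ur.
have [r' rr rs] : exists2 g, ac r g & g \in trees n d [seq z <- S | ~~ p z].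
{ apply: (IH d r _ _ _ rS ur pr rd).
  - by rewrite -(perm_size rS) (leq_trans _ Sn) // -ltnS -sS sE -add1n leq_add2r.
  - by rewrite filter_uniq. }
exists (op b c' r'); first by apply: ac_trans fr _; apply: ac_op.
have -> : trees n.+1 b (x :: S) = flatten [seq [seq op b f g | f <- trees n (~~ b) (x :: p.1),
    g <- join b (size p.2) (fun c => trees n c p.2)] | p <- splits S] by rewrite SE.
apply/flatten_mapP; exists ([seq z <- S | p z], [seq z <- S | ~~ p z]).
  exact: filter_splits.
apply: allpairs_f => //.
by apply: mem_join rs; rewrite -(perm_size rS).
Qed.

(** * Implication between positive formulae by minterms *)

Lemma nth_or_mask s t i : nth false (or_mask s t) i = nth false s i || nth false t i.
Proof.
by elim: s t i => [|x s IH] [|y t] [|i] //=; rewrite ?orbF ?IH //.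
Qed.

Lemma eval_minterm m f : pol xpredT f -> m \in minterms f -> eval (nth false m) f.
Proof.
elim: f m => //= [x m _|f IHf g IHg m /andP[pf pg] /allpairsP[[s t] /= [sf tg ->]]|f IHf g IHg m /andP[pf pg]].
- by rewrite inE => /eqP->; rewrite nth_ncons ltnn subnn.
- apply/andP; split; [apply: pol_mono (pf) _ (IHf _ pf sf)|apply: pol_mono (pg) _ (IHg _ pg tg)];
    by move=> x _ /= /eqP E; rewrite nth_or_mask -E ?orbT.
- by rewrite mem_cat => /orP[/IHf->|/IHg->] //; rewrite orbT.
Qed.

Lemma minterm_below s f : pol xpredT f -> eval s f ->
  exists2 m, m \in minterms f & forall x, nth false m x -> s x.
Proof.
elim: f => //= [_ _|x _ sx|f IHf g IHg /andP[pf pg] /andP[/(IHf pf)[m mf ms] /(IHg pg)[m' mg ms']]|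
  f IHf g IHg /andP[pf pg] /orP[/(IHf pf)|/(IHg pg)] [m mf ms]].
- by exists [::]; rewrite ?inE // => x; rewrite nth_nil.
- exists (ncons x false [:: true]); first by rewrite inE.
  move=> y; rewrite nth_ncons; case: ltnP => // xy; case E: (y - x) => [|k] /=; last by rewrite nth_nil.
  by have -> : y = x by lia.
- exists (or_mask m m'); first exact: allpairs_f.
  by move=> x; rewrite nth_or_mask => /orP[/ms|/ms'].
- by exists m; rewrite // mem_cat mf.
- by exists m; rewrite // mem_cat mf orbT.
Qed.

Lemma impliedP f g : pol xpredT f -> pol xpredT g -> reflect (le f g) (implied (minterms f) g).
Proof.
move=> pf pg; apply: (iffP allP) => [H s /(minterm_below pf)[m /H em ms]|fg m mf].
- by apply: pol_mono (pg) _ em => x _ /= /eqP/esym/ms->.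
- exact/fg/eval_minterm.
Qed.

Lemma goal_finite n f g : n <= 7 ->
  (forall f' g', weight f' + weight g' < weight f + weight g -> goal f' g') ->
  f \in shapes n true 0 n -> g \in trees n false (iota 0 n) ->
  unit_free f -> unit_free g -> pol xpredT f -> pol xpredT g ->
  rooted true f -> rooted false g -> parts_geq true 2 f -> parts_geq false 2 g -> goal f g.
Proof.
move=> n7 IH fs gs uf ug pf pg rf rg f2 g2 lf lg fg.
have /allP/(_ f) := check_le7 n7; rewrite mem_filter f2 fs => /(_ isT)/allP/(_ g).
rewrite mem_filter g2 gs => /(_ isT); rewrite /reducible; have /impliedP -> // := fg.
case: hasP => [[d /flatten_mapP[c cf /mapP[a ac_ ->]] ag] _|_ /hasP[c cg /hasP[a ac_ fa]]].
- have pc := parts_pol pf cf; have pa := parts_pol pc ac_; move/impliedP: ag => ag.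
  apply: (goal_switch IH rf cf _ ac_ (ag pa pg)) => //.
  (* The conjunct [c] has at least two variables and is not a conjunction, so it is a
     disjunction. *)
  apply: unit_free_rooted (parts_unit_free uf cf) (allP f2 _ cf) _; exact: parts_rooted cf.
- have pc := parts_pol pg cg; have pa := parts_pol pc ac_; move/impliedP: fa => fa.
  apply: (goal_switch_r IH rg cg _ ac_ (fa pf pa)) => //.
  apply: unit_free_rooted (parts_unit_free ug cg) (allP g2 _ cg) _; exact: parts_rooted cg.
Qed.

(** * Derivability of all inferences with at most 7 common variables *)

(** Signs are dropped together with names: if both sides follow the same [q], reading each literal
    as a positive variable preserves the inference. *)
Fixpoint rename (h : nat -> nat) f : form :=
  match f with
  | Top => Top
  | Bot => Bot
  | Var x | NVar x => Var (h x)
  | And f g => And (rename h f) (rename h g)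
  | Or f g => Or (rename h f) (rename h g)
  end.

Lemma rename_op h b f g : rename h (op b f g) = op b (rename h f) (rename h g).
Proof. by case: b. Qed.

Lemma vars_rename h f : vars (rename h f) = map h (vars f).
Proof. by elim: f => //= f -> g ->; rewrite map_cat. Qed.

Lemma weight_rename h f : weight (rename h f) = weight f.
Proof. by elim: f => //= f -> g ->. Qed.

Lemma unit_free_rename h f : unit_free (rename h f) = unit_free f.
Proof. by elim: f => //= f -> g ->. Qed.

Lemma pol_rename h f : pol xpredT (rename h f).
Proof. by elim: f => //= f -> g ->. Qed.

Lemma rooted_rename b h f : rooted b (rename h f) = rooted b f.
Proof. by case: f. Qed.

Lemma parts_geq_rename b k h f : parts_geq b k (rename h f) = parts_geq b k f.
Proof.
elim/form_op_ind: f => [||x|x|c f g IHf IHg]; try by case: b.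
by rewrite rename_op !parts_geq_op IHf IHg !vars_rename !size_map.
Qed.

Lemma eval_rename q h f s : pol q f -> eval s (rename h f) = eval (fun x => q x == s (h x)) f.
Proof.
elim/form_op_ind: f => //= [x qx|x /negbTE qx|b f g IHf IHg].
- by rewrite qx; case: (s _).
- by rewrite qx; case: (s _).
- by rewrite pol_op rename_op !eval_op => /andP[/IHf-> /IHg->].
Qed.

Lemma rename_ext h h' f : {in vars f, h =1 h'} -> rename h f = rename h' f.
Proof.
elim/form_op_ind: f => //= [x|x|b f g IHf IHg] E; rewrite ?E ?inE // !rename_op.
by rewrite IHf ?IHg // => x xf; apply: E; rewrite vars_op mem_cat xf ?orbT.
Qed.

(** Linearity makes the position of an occurrence a function of its variable, so the numbering of
    leaves is a renaming and can be applied to the other side as well. *)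
Lemma relabel_rename i f : linear f -> relabel i f = rename (fun x => i + index x (vars f)) f.
Proof.
elim/form_op_ind: f i => //= [x i _|x i _|b f g IHf IHg i l]; rewrite ?eqxx ?addn0 //.
have [[lf lg] d] := (linear_opI l, linear_op_disj l).
rewrite relabel_op rename_op IHf // IHg //; congr op; apply: rename_ext => x xf; rewrite vars_op index_cat.
- by rewrite xf.
- by rewrite (negbTE (d x xf)) addnA.
Qed.

Lemma subst_rename q (s : seq nat) f : {subset vars f <= s} -> pol q f ->
  subst (fun i => if i < size s then lit q (nth 0 s i) else Top) (rename (index^~ s) f) = f.
Proof.
elim/form_op_ind: f => //= [x xs qx|x xs /negbTE qx|b f g IHf IHg].
- by rewrite index_mem xs ?inE // nth_index ?xs ?inE // /lit qx.
- by rewrite index_mem xs ?inE // nth_index ?xs ?inE // /lit qx.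
- rewrite pol_op vars_op rename_op => fs /andP[pf pg].
  have -> t h k : subst t (op b h k) = op b (subst t h) (subst t k) by case: b {fs}.
  by rewrite IHf ?IHg // => x xf; apply: fs; rewrite mem_cat xf ?orbT.
Qed.

Lemma separating_lit q (s : seq nat) : uniq s ->
  separating (fun i => if i < size s then lit q (nth 0 s i) else Top).
Proof.
move=> us; split=> [x|x y z]; first by rewrite /linear; case: ifP => // _; rewrite vars_lit.
case: ifP => // xs; case: ifP => // ys; rewrite !vars_lit !inE => /eqP -> /eqP/eqP.
by rewrite nth_uniq // => /eqP.
Qed.

Lemma ac_rooted b f g : ac f g -> rooted b f = rooted b g.
Proof. by elim=> {f g} [f|f g h _ -> _ ->|c f g|c f g h|c f g h|c f f' g g' _ _ _ _] //; rewrite !rooted_op. Qed.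

Lemma goal_canonical q f g :
  (forall f' g', weight f' + weight g' < weight f + weight g -> goal f' g') ->
  unit_free f -> unit_free g -> pol q f -> pol q g -> perm_eq (vars f) (vars g) ->
  rooted true f -> rooted false g -> parts_geq true 2 f -> parts_geq false 2 g -> goal f g.
Proof.
move=> IH uf ug qf qg fg rf rg f2 g2 lf lg lefg c V fV gV.
set n := size (vars f).
have n7 : n <= 7.
  rewrite (leq_trans _ c) // /n -count_predT; apply/eq_leq/eq_in_count => x xf /=.
  by rewrite -(perm_mem fg) xf.
have [f' ff sh] : exists2 f', ac f f' & forall i, relabel i f' \in shapes n true i n.
  by apply: shapes_complete => //; case: (f) rf.
have lf' : linear f' by rewrite -(ac_linear ff).
pose h := index^~ (vars f'); pose t i := if i < size (vars f') then lit q (nth 0 (vars f') i) else Top.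
have sf' : size (vars f') = n by rewrite -(perm_size (ac_vars ff)).
have hE : relabel 0 f' = rename h f' by apply: relabel_rename.
have hf : map h (vars f') = iota 0 n by rewrite -vars_rename -hE vars_relabel sf'.
have gf : perm_eq (vars g) (vars f') by rewrite -(permPl fg) (ac_vars ff).
have hg : perm_eq (vars (rename h g)) (iota 0 n) by rewrite vars_rename -hf perm_map.
have [g' gg' tr] : exists2 g', ac (rename h g) g' & g' \in trees n false (iota 0 n).
  apply: trees_complete => //; rewrite ?size_iota ?iota_uniq ?unit_free_rename ?pol_rename //.
  by rewrite rooted_rename; case: (g) rg.
have qf' : pol q f' by rewrite -(ac_pol _ ff).
have st : separating t by apply: separating_lit.
have tV x : x \in iota 0 n -> {subset vars (t x) <= V}.
  rewrite mem_iota => /= xn y; rewrite /t sf' xn vars_lit inE => /eqP->.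
  by apply: fV; rewrite (perm_mem (ac_vars ff)) mem_nth ?sf'.
have tf : subst t (rename h f') = f' by apply: subst_rename.
have tg : subst t (rename h g) = g by apply: subst_rename => // x; rewrite (perm_mem gf).
have lg' : linear (rename h g) by rewrite /linear (perm_uniq hg) iota_uniq.
have d : der (iota 0 n) (rename h f') g'.
{ apply: (goal_finite n7).
  (* The induction hypothesis speaks of weights only, hence applies to the renamed pair. *)
  - by move=> f1 g1; rewrite weight_rename -(ac_weight gg') weight_rename -(ac_weight ff); apply: IH.
  - by rewrite -hE.
  - by [].
  - by rewrite unit_free_rename -(ac_unit_free ff).
  - by rewrite -(ac_unit_free gg') unit_free_rename.
  - exact: pol_rename.
  - by rewrite -(ac_pol _ gg') pol_rename.
  - by rewrite rooted_rename -(ac_rooted _ ff).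
  - by rewrite -(ac_rooted _ gg') rooted_rename.
  - by rewrite parts_geq_rename -(ac_parts_geq _ _ ff).
  - by rewrite -(ac_parts_geq _ _ gg') parts_geq_rename.
  - by rewrite /linear vars_rename hf iota_uniq.
  - by rewrite -(ac_linear gg').
  - move=> s; rewrite -(ac_eval gg') !(eval_rename _ _ (q := q)) // -(ac_eval ff); exact: lefg.
  - apply: leq_trans n7; rewrite -[X in _ <= X](size_iota 0 n) -hf -vars_rename; exact: count_size.
  - by move=> x; rewrite vars_rename hf.
  - by move=> x; rewrite -(perm_mem (ac_vars gg')) (perm_mem hg). }
have := der_subst st tV d; rewrite tf => d1.
have dg : der (iota 0 n) g' (rename h g).
  by apply: (der_ac (ac_sym gg')); rewrite -?(ac_linear gg') // => x; rewrite -(perm_mem (ac_vars gg')) (perm_mem hg).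
have := der_subst st tV dg; rewrite tg => d2.
by apply: der_trans (der_ac ff lf fV) (der_trans d1 d2).
Qed.

Lemma goal_and_or q f g :
  (forall f' g', weight f' + weight g' < weight f + weight g -> goal f' g') ->
  unit_free f -> unit_free g -> pol q f -> pol q g -> vars f =i vars g ->
  rooted true f -> rooted false g -> goal f g.
Proof.
move=> IH uf ug qf qg fg rf rg.
case f2: (parts_geq true 2 f); last first.
  have /allPn[c cf] := negbT f2; rewrite -ltnNge ltnS => c1.
  exact: goal_literal_part IH uf qf qg fg rf cf c1.
case g2: (parts_geq false 2 g); last first.
  have /allPn[c cg] := negbT g2; rewrite -ltnNge ltnS => c1.
  exact: goal_literal_part_r IH ug qf qg fg rg cg c1.
move=> lf lg; apply: (goal_canonical IH uf ug qf qg) => //; exact: uniq_perm.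
Qed.

Lemma goal_simp f g :
  (forall f' g', weight f' + weight g' < weight f + weight g -> goal f' g') ->
  simp f <> f -> goal f g.
Proof.
move=> IH sf lf lg fg c V fV gV; apply: (der_trans (g := simp f)).
  by apply: (der_acu (acu_simp lf) fV) => x /vars_simp/fV.
apply: IH => //.
- by case: (weight_simp f) => // w; rewrite ltn_add2r.
- exact: linear_simp.
- by move=> s; rewrite eval_simp; apply: fg.
- exact: leq_trans (count_vars_simp _ _) c.
- by move=> x /vars_simp/fV.
Qed.

Lemma goal_simp_r f g :
  (forall f' g', weight f' + weight g' < weight f + weight g -> goal f' g') ->
  simp g <> g -> goal f g.
Proof.
move=> IH sg lf lg fg c V fV gV; apply: (der_trans (g := simp g)); last first.
  by apply: (der_acu (acu_sym (acu_simp lg)) _ gV) => x /vars_simp/gV.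
apply: IH => //.
- by case: (weight_simp g) => // w; rewrite ltn_add2l.
- exact: linear_simp.
- by move=> s; rewrite eval_simp; apply: fg.
- by apply: leq_trans c; apply: sub_count => x; apply: vars_simp.
- by move=> x /vars_simp/gV.
Qed.

Lemma goal_all f g : goal f g.
Proof.
have [n] := ubnP (weight f + weight g); elim: n f g => // n IHn f g; rewrite ltnS => wn.
have {IHn}IH f' g' : weight f' + weight g' < weight f + weight g -> goal f' g'.
  by move=> w; apply: IHn; apply: leq_trans w wn.
case: (simp f =P f) => [sf|]; last exact: goal_simp.
case: (simp g =P g) => [sg|]; last exact: goal_simp_r.
move=> lf lg fg; have [q qf] := linear_pol lf; have [q' qg] := linear_pol lg.
have := simp_normal f; rewrite sf => -[fE|fE|uf].
- have := simp_normal g; rewrite sg => -[gE|gE|ug] _ V fV gV.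
  + by rewrite fE gE; apply: der_refl.
  + by have := fg xpredT; rewrite fE gE => /(_ isT).
  + by have := fg (predC q'); rewrite fE (pol_eval_false ug qg) => /(_ isT).
- by move=> _ V _ gV; rewrite fE; apply: der_bot.
- have := simp_normal g; rewrite sg => -[gE|gE|ug];
    [by move=> _ V fV _; rewrite gE; apply: der_top
    |by have := fg q; rewrite gE (pol_eval_true uf qf) => /(_ isT)|].
case mf: (all (fun x => (x \in vars g) && (q x == q' x)) (vars f)); last first.
  have /allPn[x xf] := negbT mf; rewrite negb_and => nx; apply: (goal_rep IH xf) => //.
  by apply: (le_rep qf qg fg) => xg; move: nx; rewrite xg /= eq_sym.
have {mf}/allP mf := mf.
case mg: (all [in vars f] (vars g)); last first.
  have /allPn[x xg xf] := negbT mg; apply: (goal_rep_r IH xg) => //.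
  rewrite -[f]negK -[rep _ _ _]negK; apply: le_neg; rewrite rep_neg.
  apply: (le_rep (q := predC q') (q' := predC q)); rewrite ?pol_neg //; first exact: le_neg.
  by rewrite vars_neg (negbTE xf).
have {mg}/allP mg := mg.
have E : vars f =i vars g by move=> x; apply/idP/idP => [/mf/andP[]|/mg].
have {}qg : pol q g by rewrite (pol_ext (q' := q')) // => x /mg/mf/andP[_ /eqP].
have P : perm_eq (vars f) (vars g) by apply: uniq_perm.
have lits h k x : h = lit q x -> unit_free k -> pol q k -> perm_eq (vars h) (vars k) -> h = k.
  move=> -> uk qk hk; have [y kE] : exists y, k = lit q y.
    by apply: lit_of; rewrite // -(perm_size hk) vars_lit.
  by move/perm_mem: hk => /(_ x); rewrite kE !vars_lit !inE eqxx => /esym/eqP->.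
have [[x fE]|f1] : (exists x, f = lit q x) \/ 1 < size (vars f).
+ by case: (leqP (size (vars f)) 1) => ?; [left; apply: lit_of|right].
+ by move=> _ V fV _; rewrite -(lits f g x) //; apply: der_refl.
+ have g1 : 1 < size (vars g) by rewrite -(perm_size P).
move: lf lg fg; case: (boolP (rooted false f)) => [/rootedP[h [k fE]]|rf].
  by rewrite fE in IH *; apply: goal_or.
case: (boolP (rooted true g)) => [/rootedP[h [k gE]]|rg].
  by rewrite gE in IH *; apply: goal_and.
by apply: (goal_and_or IH uf ug qf qg E); apply: unit_free_rooted.
Qed.

(** * An underivable inference on 8 variables *)

Lemma op_absorbing b c f g : (op b f g == absorbing c) = false.
Proof. by apply/eqP; case: b; case: c. Qed.

Lemma neutralE b : neutral b = absorbing (~~ b).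
Proof. by case: b. Qed.

Lemma unit_free_absorbing c f : unit_free f -> (f == absorbing c) = false.
Proof. by move=> uf; apply/eqP => fE; move: uf; rewrite {}fE; case: c. Qed.

Lemma absorbing_neutral b : (absorbing b == neutral b) = false.
Proof. by apply/eqP; case: b. Qed.

Lemma sop_absl b g : sop b (absorbing b) g = absorbing b.
Proof. by rewrite /sop eqxx. Qed.

Lemma sop_absr b f : sop b f (absorbing b) = absorbing b.
Proof. by rewrite /sop eqxx orbT. Qed.

Lemma sop_neul b g : sop b (neutral b) g = g.
Proof. by rewrite /sop [neutral b == _]eq_sym absorbing_neutral /= eqxx; case: eqP. Qed.

Lemma sop_neur b f : sop b f (neutral b) = f.
Proof.
rewrite /sop [neutral b == _]eq_sym absorbing_neutral orbF eqxx.
by case: eqP => // _; case: eqP.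
Qed.

Lemma sop_op b f g : unit_free f -> unit_free g -> sop b f g = op b f g.
Proof. by move=> uf ug; rewrite /sop neutralE !unit_free_absorbing. Qed.

Lemma simp_unit_free f : unit_free f -> simp f = f.
Proof.
elim/form_op_ind: f => // b f g IHf IHg; rewrite unit_free_op simp_op => /andP[uf ug].
by rewrite IHf ?IHg ?sop_op.
Qed.

Lemma ac_absorbing c f g : ac f g -> (f == absorbing c) = (g == absorbing c).
Proof. by elim=> {f g} [f|f g h _ -> _ ->|b f g|b f g h|b f g h|b f f' g g' _ _ _ _]; rewrite ?op_absorbing. Qed.

Lemma ac_sop b f f' g g' : ac f f' -> ac g g' -> ac (sop b f g) (sop b f' g').
Proof.
move=> ff gg; rewrite /sop neutralE !(ac_absorbing _ ff) !(ac_absorbing _ gg).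
case: ifP => _; first exact: ac_refl.
by do 2 (case: ifP => _ //); apply: ac_op.
Qed.

Lemma ac_sopC b f g : ac (sop b f g) (sop b g f).
Proof.
rewrite /sop orbC; case: ifP => _; first exact: ac_refl.
case: (f =P _) => [fE|_]; case: (g =P _) => [gE|_]; rewrite ?fE ?gE; try exact: ac_refl.
exact: ac_C.
Qed.

Lemma ac_sopA b f g h : ac (sop b f (sop b g h)) (sop b (sop b f g) h).
Proof.
case: (f =P absorbing b) => [->|/eqP/negbTE fa]; first by rewrite !sop_absl; apply: ac_refl.
case: (g =P absorbing b) => [->|/eqP/negbTE ga]; first by rewrite sop_absl !sop_absr sop_absl; apply: ac_refl.
case: (h =P absorbing b) => [->|/eqP/negbTE ha]; first by rewrite !sop_absr; apply: ac_refl.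
case: (f =P neutral b) => [->|/eqP/negbTE fn]; first by rewrite !sop_neul; apply: ac_refl.
case: (g =P neutral b) => [->|/eqP/negbTE gn]; first by rewrite sop_neul sop_neur; apply: ac_refl.
case: (h =P neutral b) => [->|/eqP/negbTE hn]; first by rewrite !sop_neur; apply: ac_refl.
have opE x y : (x == absorbing b) = false -> (y == absorbing b) = false ->
    (x == neutral b) = false -> (y == neutral b) = false -> sop b x y = op b x y.
  by rewrite /sop => -> -> -> ->.
have oN x y : (op b x y == neutral b) = false by rewrite neutralE op_absorbing.
rewrite (opE g h) // (opE f g) // (opE f) ?op_absorbing // (opE (op b f g)) ?op_absorbing //.
exact: ac_A.
Qed.

(** [sop] obeys the unit laws exactly and the other laws up to [ac], so every rule of [acu] survives
    simplification as an instance of [ac]. *)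
Lemma acu_simp_ac f g : acu f g -> ac (simp f) (simp g).
Proof.
elim=> {f g}.
1: by move=> *; apply: ac_refl.
1: by move=> *; apply: ac_sym.
1: by move=> f g h _ fg _ gh; apply: ac_trans fg gh.
1,2: by move=> *; apply: ac_sopC.
1,2: by move=> *; apply: ac_sopA.
9-12: by move=> *; apply: ac_sop => //; apply: ac_refl.
- move=> f _; rewrite [simp _](sop_neur true); exact: ac_refl.
- move=> f _; rewrite [simp _](sop_neul true); exact: ac_refl.
- move=> f _; rewrite [simp _](sop_neur false); exact: ac_refl.
- move=> f _; rewrite [simp _](sop_neul false); exact: ac_refl.
- move=> f _; rewrite [simp (And _ _)](sop_absr true); exact: ac_refl.
- move=> f _; rewrite [simp (And _ _)](sop_absl true); exact: ac_refl.
- move=> f _; rewrite [simp (Or _ _)](sop_absr false); exact: ac_refl.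
- move=> f _; rewrite [simp (Or _ _)](sop_absl false); exact: ac_refl.
Qed.

(** * Rewrite steps after simplification *)

Inductive sstep : form -> form -> Prop :=
| sstep_switch f g h : sstep (And f (Or g h)) (Or (And f g) h)
| sstep_medial e f g h : sstep (Or (And e f) (And g h)) (And (Or e g) (Or f h))
| sstep_opl b f g h : sstep f g -> sstep (op b f h) (op b g h)
| sstep_opr b f g h : sstep f g -> sstep (op b h f) (op b h g).

(** Says that no variable sits beside an absorbing unit, where simplification would discard it. *)
Definition full f : bool := size (vars (simp f)) == size (vars f).

Lemma size_vars_simp f : size (vars (simp f)) <= size (vars f).
Proof. by rewrite -!count_predT count_vars_simp. Qed.

Lemma size_vars_sop b f g : size (vars (sop b f g)) <= size (vars f) + size (vars g).
Proof. by case: sopP => *; rewrite ?vars_absorbing ?vars_op ?size_cat /=; lia. Qed.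

Lemma full_op b f g : full (op b f g) -> full f /\ full g.
Proof.
rewrite /full simp_op vars_op size_cat => /eqP E.
have := size_vars_sop b (simp f) (simp g); have := size_vars_simp f; have := size_vars_simp g; rewrite E.
by move=> *; split; apply/eqP; lia.
Qed.

Definition sopE := (sop_neul true : forall g, sop true Top g = g, sop_neur true : forall g, sop true g Top = g,
  sop_neul false : forall g, sop false Bot g = g, sop_neur false : forall g, sop false g Bot = g,
  sop_absl true : forall g, sop true Bot g = Bot, sop_absr true : forall g, sop true g Bot = Bot,
  sop_absl false : forall g, sop false Top g = Top, sop_absr false : forall g, sop false g Top = Top).

(** What is left of a step between full formulae once units are simplified. Weakening a variable, as
    in [der_bot], would discard it on one side and is excluded; only [Bot] to [Top] remains of
    weakening. *)
Definition trivial_step f g : Prop := [\/ ac f g, sstep f g | f = Bot /\ g = Top].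

Lemma simp_switch f g h :
  full (And f (Or g h)) -> full (Or (And f g) h) ->
  trivial_step (simp (And f (Or g h))) (simp (Or (And f g) h)).
Proof.
move=> l r; have [ff gh] := full_op (b := true) l; have [fg fh] := full_op (b := false) gh.
move: l r; rewrite /full /= !size_cat -(eqP ff) -(eqP fg) -(eqP fh).
case: (simp_normal f) => [->|->|uf]; case: (simp_normal g) => [->|->|ug]; case: (simp_normal h) => [->|->|uh];
  rewrite ?sopE ?sop_op //= ?uf ?ug ?uh //= ?size_cat => /eqP l /eqP r.
all: try by (constructor 1; apply: ac_refl).
all: try by (constructor 3).
all: try by (constructor 2; constructor).
(* In the remaining cases a unit absorbs a nonempty argument on one side, against fullness. *)
all: exfalso; try have := unit_free_vars uf; try have := unit_free_vars ug; try have := unit_free_vars uh; move: l r => /=; lia.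
Qed.

Lemma simp_medial e f g h :
  full (Or (And e f) (And g h)) -> full (And (Or e g) (Or f h)) ->
  trivial_step (simp (Or (And e f) (And g h))) (simp (And (Or e g) (Or f h))).
Proof.
move=> l r; have [ef gh] := full_op (b := false) l; have [fe ff] := full_op (b := true) ef.
have [fg fh] := full_op (b := true) gh.
move: l r; rewrite /full /= !size_cat -(eqP fe) -(eqP ff) -(eqP fg) -(eqP fh).
case: (simp_normal e) => [->|->|ue]; case: (simp_normal f) => [->|->|uf];
  case: (simp_normal g) => [->|->|ug]; case: (simp_normal h) => [->|->|uh];
  rewrite ?sopE ?sop_op //= ?ue ?uf ?ug ?uh //= ?size_cat => /eqP l /eqP r.
all: try by (constructor 1; apply: ac_refl).
all: try by (constructor 3).
all: try by (constructor 2; constructor).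
all: exfalso; try have := unit_free_vars ue; try have := unit_free_vars uf; try have := unit_free_vars ug; try have := unit_free_vars uh; move: l r => /=; lia.
Qed.

Lemma sstep_absorbing f g : sstep f g -> forall c, (f == absorbing c) = false /\ (g == absorbing c) = false.
Proof.
case=> {f g} [f g h|e f g h|b f g h _|b f g h _] c; rewrite ?op_absorbing //.
- by rewrite (op_absorbing true) (op_absorbing false).
- by rewrite (op_absorbing true) (op_absorbing false).
Qed.

Lemma trivial_step_sop b f g h : trivial_step f g -> [\/ h = Top, h = Bot | unit_free h] ->
  size (vars (sop b f h)) = size (vars f) + size (vars h) ->
  size (vars (sop b g h)) = size (vars g) + size (vars h) ->
  trivial_step (sop b f h) (sop b g h) /\ trivial_step (sop b h f) (sop b h g).
Proof.
move=> fg hE sf sg; case: fg => [fg|fg|[fE gE]].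
- by split; constructor 1; apply: ac_sop => //; apply: ac_refl.
- case: (h =P absorbing b) => [->|/eqP/negbTE ha].
    by rewrite !sop_absr !sop_absl; split; constructor 1; apply: ac_refl.
  case: (h =P neutral b) => [->|/eqP/negbTE hn]; first by rewrite !sop_neur !sop_neul; split; constructor 2.
  rewrite /sop neutralE !(proj1 (sstep_absorbing fg _)) !(proj2 (sstep_absorbing fg _)) ha /= -neutralE hn.
  by split; constructor 2; [apply: sstep_opl|apply: sstep_opr].
- move: sf sg; rewrite fE gE; case: b; case: hE => [->|->|uh]; rewrite ?sopE //=;
    try by move=> _ _; split; first [constructor 3; split; reflexivity | constructor 1; apply: ac_refl].
  (* If [h] has variables, one of [Bot] and [Top] absorbs them under [op b], against [sf] or
     [sg]. *)
  all: by have := unit_free_vars uh; lia.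
Qed.

Lemma simp_step f g : step SM f g -> full f -> full g -> trivial_step (simp f) (simp g).
Proof.
have ctx b h k e : full (op b h e) -> full (op b k e) -> (full h -> full k -> trivial_step (simp h) (simp k)) ->
    trivial_step (simp (op b h e)) (simp (op b k e)) /\ trivial_step (simp (op b e h)) (simp (op b e k)).
  have fullE c x y : full (op c x y) ->
      size (vars (sop c (simp x) (simp y))) = size (vars (simp x)) + size (vars (simp y)).
    move=> l; have [/eqP xf /eqP yf] := full_op l.
    by move: l; rewrite /full simp_op vars_op size_cat -xf -yf => /eqP.
  move=> lh lk; have [[fh _] [fk _]] := (full_op lh, full_op lk) => /(_ fh fk) t.
  by rewrite !simp_op; apply: trivial_step_sop (simp_normal e) (fullE _ _ _ lh) (fullE _ _ _ lk).
have fullC b h k : full (op b h k) = full (op b k h).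
  by rewrite /full !simp_op (perm_size (ac_vars (ac_sopC b _ _))) !vars_op !size_cat addnC.
elim=> {f g} [l r t [[-> ->]|[-> ->]] _ _|f g h _ IH _ _|f g h _ IH _ _|f g h _ IH _ _|f g h _ IH _ _].
- exact: simp_switch.
- exact: simp_medial.
- by move=> l r; case: (ctx true f g h).
- by rewrite (fullC true h f) (fullC true h g) => l r; case: (ctx true f g h).
- by move=> l r; case: (ctx false f g h).
- by rewrite (fullC false h f) (fullC false h g) => l r; case: (ctx false f g h).
Qed.

(** * Enumerating an associative-commutative class and its reducts *)

Fixpoint commutations f : seq form :=
  match f with
  | And g h => [seq And x y | x <- commutations g, y <- commutations h] ++
               [seq And x y | x <- commutations h, y <- commutations g]
  | Or g h => [seq Or x y | x <- commutations g, y <- commutations h] ++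
              [seq Or x y | x <- commutations h, y <- commutations g]
  | _ => [:: f]
  end.

Lemma commutations_op b f g : commutations (op b f g) =
  [seq op b x y | x <- commutations f, y <- commutations g] ++
  [seq op b x y | x <- commutations g, y <- commutations f].
Proof. by case: b. Qed.

Lemma commutations_refl f : f \in commutations f.
Proof.
elim/form_op_ind: f => [||x|x|b f g IHf IHg]; rewrite ?inE //.
by rewrite commutations_op mem_cat allpairs_f.
Qed.

(* Every connective has exactly two arguments up to associativity. *)
Fixpoint binary f : bool :=
  match f with
  | And g h => [&& ~~ rooted true g, ~~ rooted true h, binary g & binary h]
  | Or g h => [&& ~~ rooted false g, ~~ rooted false h, binary g & binary h]
  | _ => true
  end.

Lemma binary_op b f g : binary (op b f g) = [&& ~~ rooted b f, ~~ rooted b g, binary f & binary g].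
Proof. by case: b. Qed.

(** Associativity never applies to a [binary] formula, and swapping arguments keeps it [binary]; so
    its class consists of the swaps alone. *)
Lemma ac_commutations f g : ac f g -> binary f -> binary g /\ commutations f =i commutations g.
Proof.
elim=> {f g} [f|f g h _ IH1 _ IH2 /IH1[/IH2[-> E2] E1]|b f g|b f g h|b f g h|b f f' g g' ff IHf gg IHg] //.
- by split=> // x; rewrite E1.
- rewrite !binary_op => /and4P[-> -> -> ->]; split=> // x.
  by rewrite !commutations_op !mem_cat orbC.
- by rewrite binary_op rooted_op eqxx andbF.
- by rewrite binary_op rooted_op eqxx.
- rewrite !binary_op -(ac_rooted _ ff) -(ac_rooted _ gg) => /and4P[-> -> /IHf[-> Ef] /IHg[-> Eg]].
  split=> // x; rewrite !commutations_op !mem_cat; congr (_ || _);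
    by apply/allpairsP/allpairsP => -[[y z] /= [yf zg ->]]; exists (y, z); rewrite ?Ef ?Eg // -?Ef -?Eg.
Qed.

Fixpoint reducts f : seq form :=
  match f with
  | And g h => (if h is Or h1 h2 then [:: Or (And g h1) h2] else [::]) ++
               [seq And x h | x <- reducts g] ++ [seq And g x | x <- reducts h]
  | Or g h => (if g is And g1 g2 then if h is And h1 h2 then [:: And (Or g1 h1) (Or g2 h2)] else [::] else [::]) ++
              [seq Or x h | x <- reducts g] ++ [seq Or g x | x <- reducts h]
  | _ => [::]
  end.

Lemma sstep_reducts f g : sstep f g -> g \in reducts f.
Proof.
elim=> {f g} [f g h|e f g h|b f g h _ IH|b f g h _ IH]; rewrite /= ?inE ?eqxx //.
- have := map_f (op b ^~ h) IH; case: b => /= H; by rewrite !mem_cat H ?orbT.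
- have := map_f (op b h) IH; case: b => /= H; by rewrite !mem_cat H ?orbT.
Qed.

Lemma sstep_pol q f g : sstep f g -> pol q f -> pol q g.
Proof.
elim=> {f g} [f g h|e f g h|b f g h _ IH|b f g h _ IH] /=; rewrite ?pol_op.
- by case/and3P=> -> -> ->.
- by case/andP=> /andP[-> ->] /andP[-> ->].
- by case/andP=> /IH-> ->.
- by case/andP=> -> /IH->.
Qed.

(** This formula is [binary] with seven connectives, so it suffices to examine the reducts of its
    128 commutations. *)
Definition phi8 : form :=
  And (Or (Var 0) (And (Var 1) (Var 2)))
      (Or (And (Var 3) (Var 4)) (And (Or (Var 5) (Var 6)) (Var 7))).

Definition psi8 : form :=
  Or (And (Var 0) (Or (Var 3) (Var 5)))
     (And (Or (Var 1) (Var 6)) (Or (And (Var 2) (Var 4)) (Var 7))).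

Lemma le_phi8_psi8 : le phi8 psi8.
Proof. by apply/impliedP => //; vm_compute. Qed.

Lemma phi8_stuck f g : f \in commutations phi8 -> g \in reducts f -> ~~ implied (minterms g) psi8.
Proof.
have : all (fun f => all (fun g => ~~ implied (minterms g) psi8) (reducts f)) (commutations phi8) by vm_compute.
by move=> /allP H /H /allP H'; apply: H'.
Qed.

(** For each [x] some minterm of [phi8] satisfies [phi8] with [x] set to true but falsifies [psi8]
    with [x] set to false. A formula between the two without [x] would take the same value at both
    assignments. *)
Lemma essential8 f x : le phi8 f -> le f psi8 -> x < 8 -> x \in vars f.
Proof.
move=> pf fp x8; apply: contraT => xf.
have : all (fun x => has (fun m => eval (fun y => (y == x) || nth false m y) phi8 &&
    ~~ eval (fun y => (y != x) && nth false m y) psi8) (minterms phi8)) (iota 0 8) by vm_compute.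
move=> /allP/(_ x); rewrite mem_iota => /(_ x8)/hasP[m _ /andP[/pf ef /negP[]]].
apply: fp; rewrite -(eval_ext _ (s := fun y => (y == x) || nth false m y)) // => y yf /=.
by case: eqP yf xf => // -> ->.
Qed.

Lemma full8 f : linear f -> {subset vars f <= iota 0 8} -> le phi8 f -> le f psi8 -> full f.
Proof.
move=> lf f8 pf fp; rewrite /full eqn_leq size_vars_simp /=.
apply: (@leq_trans 8); first exact: uniq_leq_size lf f8.
rewrite -{1}(size_iota 0 8); apply: uniq_leq_size (iota_uniq _ _) _ => x; rewrite mem_iota => x8.
by apply: essential8 => // s; rewrite eval_simp; [apply: pf|apply: fp].
Qed.

(** The invariant is that the simplified formula stays in the class of [phi8]. Soundness keeps every
    intermediate formula between [phi8] and [psi8], hence full. *)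
Lemma der8 f g : der (iota 0 8) f g -> le phi8 f -> le g psi8 -> ac phi8 (simp f) -> ac phi8 (simp g).
Proof.
elim=> {f g} [f g fg _ _|f g fg f8|f g h fg IH1 gh IH2] pf gp E.
- exact: ac_trans E (acu_simp_ac fg).
- have [lf lg] := step_linear fg; have le_fg := step_sound fg.
  have ff : full f by apply: full8 => // s /le_fg; apply: gp.
  have fg8 : full g.
    apply: full8 => // [x|s /pf/le_fg //]; rewrite -(perm_mem (step_vars fg)); exact: f8.
  have [H|H|[fB _]] := simp_step fg ff fg8; first exact: ac_trans E H.
  + have [_ C] := ac_commutations E isT.
    have := phi8_stuck (f := simp f) _ (sstep_reducts H); rewrite C commutations_refl => /(_ isT).
    have pg : pol xpredT (simp g) by apply: sstep_pol H _; rewrite -(ac_pol _ E).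
    by case: impliedP => // -[] s; rewrite eval_simp; apply: gp.
  + by have := ac_unit_free E; rewrite fB.
- apply: IH2 => //; first by move=> s /pf; apply: (der_sound fg).
  by apply: IH1 => // s; move/(der_sound gh); apply: gp.
Qed.

Lemma psi8_not_derivable : ~ derivable_u SM phi8 psi8.
Proof.
move=> /der_derivable/(_ isT)[V d].
(* The derivation may pass through other variables; this leaves [phi8] and [psi8] unchanged and
   confines it to the eight. *)
pose t x := if x < 8 then Var x else Bot.
have st : separating t.
  split=> [x|x y z]; rewrite /t; first by case: ifP.
  by case: ifP => // _; case: ifP => // _; rewrite !inE => /eqP<- /eqP.
have tV x : x \in V -> {subset vars (t x) <= iota 0 8}.
  by move=> _ y; rewrite /t; case: ifP => // x8; rewrite inE mem_iota => /eqP->.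
have d8 : der (iota 0 8) phi8 psi8 := der_subst st tV d.
have E : ac phi8 (simp psi8).
  by apply: (der8 d8) => //; rewrite simp_unit_free //; apply: ac_refl.
(* Variables 0 and 3 satisfy the first disjunct of [psi8], but not the second conjunct of [phi8]. *)
have := ac_eval E (fun x => (x == 0) || (x == 3)).
by rewrite simp_unit_free.
Qed.

Theorem theorem2p9 :
  (forall (phi psi : form) (V1 V2 : seq nat),
      uniq V1 -> uniq V2 ->
      linear_on phi V1 -> linear_on psi V2 ->
      inference phi psi ->
      size [seq x <- V1 | x \in V2] <= 7 ->
      derivable_u SM phi psi)
  /\
  (exists (phi psi : form) (V : seq nat),
      uniq V /\ size V = 8 /\ linear_on phi V /\ linear_on psi V /\
      inference phi psi /\ ~ derivable_u SM phi psi).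
Proof.
split.
- move=> phi psi V1 V2 u1 u2 [l1 phi1] [l2 psi2] [_ [_ le12]] c.
  apply: (@derivable_der (vars phi ++ vars psi)); apply: goal_all => //.
  + rewrite (permP (uniq_perm l1 u1 phi1)) -size_filter.
    by rewrite -(eq_filter (a1 := [in V2])) // => x; rewrite /= psi2.
  + exact: subsetl.
  + exact: subsetr.
- exists phi8, psi8, (iota 0 8).
  have p1 : perm_eq (vars phi8) (iota 0 8) by [].
  have p2 : perm_eq (vars psi8) (iota 0 8) by [].
  do !split=> //; try exact: perm_mem.
  + exact: le_phi8_psi8.
  + exact: psi8_not_derivable.
Qed.
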